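(* Let $G=(V,E)$ be a finite undirected graph, let $\emptyset\neq V_0\subsetneq V_1\subsetneq\cdots\subsetneq V_k\subsetneq V$ be a chain of vertex sets, and let $x\in\mathbb{R}^E$ be a chain-point for this chain. Let the distinct values among the narrow cut sizes $x(\delta(V_i))$, $i=0,\dots,k$, be $2-\lambda_1>2-\lambda_1-\lambda_2>\cdots>2-\lambda_1-\cdots-\lambda_\ell=1$ (so $\ell$ is the number of distinct values and $\lambda_1,\dots,\lambda_\ell>0$). For $j=1,\dots,\ell$ let $\mathcal{B}_j$ be the set of Gao-trees of $G$ for the chain formed by the sets $\{V_i: x(\delta(V_i))\le 2-\lambda_1-\cdots-\lambda_j\}$. Then there exists a layered convex combination for $x$, i.e., there exist $x_1,\dots,x_\ell\in\mathbb{R}^E$ such that each $x_j$ lies in the convex hull of (the incidence vectors of) the trees in $\mathcal{B}_j$ and $x=\sum_{j=1}^{\ell}\lambda_j x_j$.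
   Context: For $S_1,S_2\subseteq V$, $\delta(S_1,S_2)$ is the set of edges with one end in $S_1$ and the other in $S_2$; $E(S)=\delta(S,S)$; $\delta(S)=\delta(S,V\setminus S)$; $\delta(v)=\delta(\{v\})$. For $F\subseteq E$, $x(F)=\sum_{e\in F}x_e$; edge sets are identified with their incidence vectors. The spanning tree polytope is $\mathrm{Sp}(G)=\{x\in\mathbb{R}^E: x\ge 0,\ x(E(U))\le |U|-1 \text{ for all nonempty } U\subseteq V,\ x(E)=|V|-1\}$. Given a chain $\emptyset\neq V_0\subsetneq V_1\subsetneq\cdots\subsetneq V_k\subsetneq V$, set $V_{-1}=\emptyset$, $V_{k+1}=V$ and define the level sets $L_i=V_i\setminus V_{i-1}$ for $i=0,\dots,k+1$. A vector $x\in\mathbb{R}^E$ is a chain-point for the chain if (i) $x\in\mathrm{Sp}(G)$; (ii) $x(\delta(V_0))=x(\delta(V_k))=1$ and $x(\delta(V_i))<2$ for $i=1,\dots,k-1$; (iii) $\sum_{v\in L_i}x(\delta(v))=2|L_i|$ for $i=1,\dots,k$. A Gao-tree for a chain $W_0\subsetneq\cdots\subsetneq W_m$ is a spanning tree of $G$ that contains exactly one edge of each cut $\delta(W_i)$, $i=0,\dots,m$. The values $x(\delta(V_i))$ are called narrow cut sizes. *)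

(* Defs.v *)
From mathcomp Require Import all_boot all_order all_algebra.
From mathcomp Require Import reals.

Set Implicit Arguments.
Unset Strict Implicit.
Unset Printing Implicit Defensive.

Import Order.TTheory GRing.Theory Num.Theory.

Local Open Scope ring_scope.

(* A finite undirected graph has finite types V of vertices and E of edges;
   ends e lists the two ends of e in an arbitrary order, which every notion
   below ignores.  Parallel edges and loops are allowed; every point of the
   spanning tree polytope vanishes on loops. *)

Section Graph.
Variables (V E : finType) (ends : E -> V * V).

Definition joins (e : E) (u v : V) : bool :=
  (ends e == (u, v)) || (ends e == (v, u)).

Definition edges_between (S1 S2 : {set V}) : {set E} :=
  [set e | ((ends e).1 \in S1) && ((ends e).2 \in S2)
        || ((ends e).1 \in S2) && ((ends e).2 \in S1)].

Definition induced_edges (S : {set V}) : {set E} := edges_between S S.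

Definition cut (S : {set V}) : {set E} := edges_between S (~: S).

Definition spans_connected (T : {set E}) : Prop :=
  forall u v : V, connect (fun a b => [exists e in T, joins e a b]) u v.

(* A cycle of length n.+1: loops are the cycles of length 1 and pairs of
   parallel edges those of length 2; ordS is the cyclic successor. *)
Definition has_cycle (T : {set E}) : Prop :=
  exists (n : nat) (v : 'I_n.+1 -> V) (e : 'I_n.+1 -> E),
    [/\ injective v, injective e, (forall i, e i \in T)
      & forall i, joins (e i) (v i) (v (ordS i))].

Definition spanning_tree (T : {set E}) : Prop :=
  spans_connected T /\ ~ has_cycle T.

(* Only the members of the chain matter, so it is given as a set of sets. *)
Definition Gao_tree (W : {set {set V}}) (T : {set E}) : Prop :=
  spanning_tree T /\ forall S, S \in W -> #|T :&: cut S| = 1%N.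

Definition is_chain (k : nat) (C : 'I_k.+1 -> {set V}) : Prop :=
  [/\ C ord0 != set0, (forall i j : 'I_k.+1, (i < j)%N -> C i \proper C j)
    & C ord_max \proper [set: V]].

Definition chain_at (k : nat) (C : 'I_k.+1 -> {set V}) (i : nat) : {set V} :=
  if insub i is Some j then C j else [set: V].

Definition level (k : nat) (C : 'I_k.+1 -> {set V}) (i : nat) : {set V} :=
  chain_at C i :\: (if i is i'.+1 then chain_at C i' else set0).

Section Weights.
Variable R : realType.

Definition weight (x : E -> R) (F : {set E}) : R := \sum_(e in F) x e.

Definition in_spanning_tree_polytope (x : E -> R) : Prop :=
  [/\ forall e, 0 <= x e,
      forall U : {set V}, U != set0 ->
        weight x (induced_edges U) <= #|U|%:R - 1
    & weight x [set: E] = #|V|%:R - 1].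

Definition chain_point (k : nat) (C : 'I_k.+1 -> {set V}) (x : E -> R) : Prop :=
  [/\ in_spanning_tree_polytope x,
      [/\ weight x (cut (C ord0)) = 1, weight x (cut (C ord_max)) = 1
        & forall i : 'I_k.+1, (0 < i < k)%N -> weight x (cut (C i)) < 2]
    & forall i : nat, (1 <= i <= k)%N ->
        \sum_(v in level C i) weight x (cut [set v]) = 2 * #|level C i|%:R].

(* With layers indexed from 0, layer_value lam j is
   2 - lambda_1 - ... - lambda_(j+1). *)
Definition layer_value (l : nat) (lam : 'I_l -> R) (j : 'I_l) : R :=
  2 - \sum_(t < l | (t <= j)%N) lam t.

(* Positivity of lam makes the layer values pairwise distinct and strictly
   decreasing, so l is the number of distinct narrow cut sizes. *)
Definition narrow_cut_layers (k : nat) (C : 'I_k.+1 -> {set V}) (x : E -> R)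
    (l : nat) (lam : 'I_l -> R) : Prop :=
  [/\ forall j, 0 < lam j,
      forall r : R, (exists i, weight x (cut (C i)) = r)
                    <-> (exists j, layer_value lam j = r)
    & 2 - \sum_(t < l) lam t = 1].

Definition narrow_sets (k : nat) (C : 'I_k.+1 -> {set V}) (x : E -> R)
    (r : R) : {set {set V}} :=
  [set C i | i : 'I_k.+1 & weight x (cut (C i)) <= r].

Definition in_convex_hull (B : {set E} -> Prop) (y : E -> R) : Prop :=
  exists (n : nat) (c : 'I_n -> R) (T : 'I_n -> {set E}),
    [/\ forall i, 0 <= c i, \sum_(i < n) c i = 1, forall i, B (T i)
      & forall e, y e = \sum_(i < n) c i * (e \in T i)%:R].

Definition layered_convex_combination (k : nat) (C : 'I_k.+1 -> {set V})
    (x : E -> R) (l : nat) (lam : 'I_l -> R) (y : 'I_l -> E -> R) : Prop :=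
  (forall j, in_convex_hull (Gao_tree (narrow_sets C x (layer_value lam j)))
               (y j))
  /\ (forall e, x e = \sum_(j < l) lam j * y j e).

End Weights.
End Graph.

(* Main.v *)
Require Import Defs.
From mathcomp Require Import all_boot all_order all_algebra.
From mathcomp Require Import boolp reals.
From mathcomp Require Import zify ring lra.

(** The layers are peeled off one at a time.  Suppose that x has mass mu (it
    lies in mu times the spanning tree polytope) and that all cuts of the
    current chain have weight at most 2 mu - lam.  Then x = lam y + z, where y
    is a convex combination of Gao-trees and z has mass mu - lam.  Gao-trees
    have weight 1 on each cut of the chain and the right degree sums between
    two members of the chain, so z satisfies the same hypotheses for the chain
    of the cuts of weight less than 2 mu - lam.

    The Gao-trees of a chain are the bases of a matroid: the direct sum of the
    graphic matroids of the levels and of the rank one matroids on the edges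
    between consecutive levels.  With r1 its rank function and r the graphic
    rank function, Farkas' lemma and the greedy algorithm reduce the splitting
    of x to x(F) <= lam r1(F) + (mu - lam) r(F) for all edge sets F.  Let F be
    a largest violator.  Every interval M of levels satisfies
    x(E(M)) >= mu |M| - 2 mu + lam, so by submodularity each component of F
    meets each level in a connected piece, and F has an edge between two
    consecutive levels whenever one of its components meets both; otherwise F
    could be enlarged by some E(M).  The edges of such an F are then charged to
    the levels that they cross. *)

Set Implicit Arguments.
Unset Strict Implicit.
Unset Printing Implicit Defensive.

Import Order.TTheory GRing.Theory Num.Theory.

Local Open Scope ring_scope.

(** * Separation and the greedy algorithm *)

Section Farkas.
Variables (R : realType) (I : finType).
Implicit Types (a : nat -> I -> R) (c w : I -> R).

Definition dotf c w : R := \sum_i c i * w i.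

Lemma dotfBl c d (z : R) w :
  dotf (fun i => c i - z * d i) w = dotf c w - z * dotf d w.
Proof.
by rewrite /dotf mulr_sumr -sumrB; apply: eq_bigr => i _; ring.
Qed.

Lemma dotfBr c w (z : R) d :
  dotf c (fun i => w i - z * d i) = dotf c w - z * dotf c d.
Proof.
by rewrite /dotf mulr_sumr -sumrB; apply: eq_bigr => i _; ring.
Qed.

Lemma dotfZr c (z : R) w : dotf c (fun i => z * w i) = z * dotf c w.
Proof. by rewrite /dotf mulr_sumr; apply: eq_bigr => i _; ring. Qed.

(* Bartl's induction: if the last generator is indispensable, some z makes it
   positive while the target is positive and the others are nonpositive;
   project all functionals along z. *)
Lemma farkas m a c :
  (forall w, (forall k, (k < m)%N -> dotf (a k) w <= 0) -> dotf c w <= 0) ->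
  exists2 q : nat -> R, (forall k, 0 <= q k) &
    forall i, c i = \sum_(k < m) q k * a k i.
Proof.
elim: m a c => [|m IHm] a c ac.
  exists (fun=> 0) => // i; rewrite big_ord0.
  have cc : dotf c c <= 0 by exact: ac.
  have cc0 : dotf c c == 0.
    by rewrite eq_le cc; apply: sumr_ge0 => j _; rewrite -expr2 sqr_ge0.
  have /allP/(_ i) : all (fun i => (true ==> (c i * c i == 0))) (index_enum I).
    rewrite -psumr_eq0 // => j _; by rewrite -expr2 sqr_ge0.
  by rewrite mem_index_enum mulf_eq0 orbb => /(_ isT)/eqP.
have [am|/existsNP[z0 /not_implyP[z0m /negP]]] := pselect (forall w,
    (forall k, (k < m)%N -> dotf (a k) w <= 0) -> dotf c w <= 0).
  have [q q0 cq] := IHm a c am.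
  exists (fun k => if (k < m)%N then q k else 0) => [k|i]; first by case: ifP.
  rewrite big_ord_recr /= ltnn mul0r addr0 cq.
  by apply: eq_bigr => k _; rewrite ltn_ord.
rewrite -ltNge => cz0.
have amz0 : 0 < dotf (a m) z0.
  rewrite ltNge; apply/negP => amz0; move: cz0; apply/negP; rewrite -leNgt.
  by apply: ac => k; rewrite ltnS leq_eqVlt => /predU1P[->//|/z0m].
pose z i := (dotf (a m) z0)^-1 * z0 i.
have amz : dotf (a m) z = 1 by rewrite dotfZr mulVf ?gt_eqF.
have zm k : (k < m)%N -> dotf (a k) z <= 0.
  move=> km; rewrite dotfZr pmulr_rle0 ?invr_gt0 //; exact: z0m.
have cz : 0 < dotf c z by rewrite dotfZr mulr_gt0 ?invr_gt0.
pose a' k i := a k i - dotf (a k) z * a m i.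
pose c' i := c i - dotf c z * a m i.
have [w aw|q q0 cq] := IHm a' c'.
  have := ac (fun i => w i - dotf (a m) w * z i).
  rewrite dotfBr dotfBl [_ * dotf c z]mulrC; apply => k.
  rewrite ltnS leq_eqVlt dotfBr => /predU1P[->|km]; first by rewrite amz; lra.
  by have := aw k km; rewrite dotfBl [dotf (a m) w * _]mulrC.
(* The last coefficient restores the multiples of [a m] that the projection removed; it is
   nonnegative as [z] is positive on [c] and nonpositive on the other generators. *)
exists (fun k => if (k < m)%N then q k
                 else dotf c z - \sum_(j < m) q j * dotf (a j) z) => [k|i].
  case: ifP => // _; rewrite subr_ge0 (le_trans _ (ltW cz))//.
  by apply: sumr_le0 => j _; rewrite mulr_ge0_le0 // zm.
rewrite big_ord_recr /= ltnn.
under eq_bigr => k _ do rewrite ltn_ord.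
have := cq i.
rewrite (eq_bigr (fun k : 'I_m => q k * a k i - q k * dotf (a k) z * a m i));
  last by move=> k _; rewrite /a'; ring.
rewrite sumrB -mulr_suml => /eqP; rewrite subr_eq => /eqP ->; ring.
Qed.

End Farkas.

(* Farkas' lemma, homogenized by one extra coordinate. *)
Lemma convex_hull_separation (R : realType) (I J : finType) (P : pred J)
    (p : J -> I -> R) (x : I -> R) :
  (forall w t, (forall j, P j -> dotf (p j) w <= t) -> dotf x w <= t) ->
  exists c : J -> R, [/\ forall j, 0 <= c j, \sum_(j | P j) c j = 1
    & forall i, x i = \sum_(j | P j) c j * p j i].
Proof.
move=> xp.
pose hom (u : I -> R) (o : option I) := if o is Some i then u i else 1.
have homE u (w : option I -> R) :
    dotf (hom u) w = w None + dotf u (fun i => w (Some i)).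
  rewrite /dotf (bigD1 None) //= mul1r; congr (_ + _).
  rewrite (reindex_omap Some id) => [|[]//] /=.
  by apply: eq_bigl => i; rewrite eqxx.
have [s sP] : exists s : seq J, s = enum P by exists (enum P).
have [w ws|q q0 xq] := @farkas R (option I) (size s)
    (fun k => hom (nth (fun=> 0) (map p s) k)) (hom x).
  rewrite homE -lerBrDl; rewrite sub0r; apply: xp => j Pj.
  have js : j \in s by rewrite sP mem_enum.
  have := ws (index j s); rewrite index_mem js => /(_ isT).
  by rewrite homE (nth_map j) ?index_mem // nth_index // -lerBrDl sub0r.
have us : uniq s by rewrite sP enum_uniq.
have sumE (g : R -> (I -> R) -> R) :
    \sum_(k < size s) g (q k) (nth (fun=> 0) (map p s) k) =
    \sum_(j | P j) g (q (index j s)) (p j).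
  transitivity (\sum_(j <- s) g (q (index j s)) (p j)); last first.
    by rewrite {1}sP big_enum.
  case: (s) us => [|j0 s']; first by rewrite big_ord0 big_nil.
  move=> us; rewrite [RHS](big_nth j0) big_mkord; apply: eq_bigr => k _.
  by rewrite (nth_map j0) // index_uniq.
exists (fun j => q (index j s)); split=> [//||i].
  have := xq None; rewrite /= => ->.
  rewrite -(sumE (fun a _ => a)); by apply: eq_bigr => k _; rewrite mulr1.
by have := xq (Some i); rewrite /= => ->; rewrite -(sumE (fun a u => a * u i)).
Qed.

(** * Submodular rank functions and greedy bases *)

Section RankFunctions.
Variable E : finType.
Implicit Types (r : {set E} -> nat) (A B S T X Y Z : {set E}).
Local Open Scope nat_scope.

(** Submodularity in its one-element form, which can be checked edge by edge; [submodular] recovers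
    the usual form. *)
Definition diminishing r := forall A B e, A \subset B ->
  r (e |: B) + r A <= r B + r (e |: A).

Definition rank_function r := [/\ r set0 = 0,
  forall A e, r A <= r (e |: A) <= (r A).+1 & diminishing r].

Definition base r T := [forall S, #|T :&: S| <= r S] && (#|T| == r setT).

Lemma diminishingU r X Y Z : diminishing r -> X \subset Y ->
  r (Y :|: Z) + r X <= r Y + r (X :|: Z).
Proof.
move=> dr XY; have [n] := ubnP #|Z|; elim: n Z => // n IHn Z Zn.
have [->|[e eZ]] := set_0Vmem Z; first by rewrite !setU0.
have ZE W : e |: (W :|: Z :\ e) = W :|: Z by rewrite setUCA setD1K.
have := IHn (Z :\ e); have := cardsD1 e Z; rewrite eZ => ZD.
have /[swap] /[apply] : #|Z :\ e| < n by lia.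
have := dr (X :|: Z :\ e) (Y :|: Z :\ e) e (setSU _ XY).
rewrite !ZE; lia.
Qed.

Lemma submodular r A B : diminishing r ->
  r (A :|: B) + r (A :&: B) <= r A + r B.
Proof.
move=> dr; have := diminishingU B dr (subsetIl A B).
by rewrite (setUidPr (subsetIr A B)).
Qed.

(** The greedy algorithm keeps an element of [s] exactly when it raises the rank of the prefix, so
    the base is tight on every prefix. *)
Lemma greedy_base r (s : seq E) : rank_function r -> uniq s ->
  s =i E -> exists2 T, base r T &
    forall i, #|T :&: [set:: take i s]| = r [set:: take i s].
Proof.
case=> r0 r1 rd us sE.
(* The trace of [T] on [S] is bounded by the rank of the part of [S] scanned so far, which leaves
   room for later elements. *)
suff [T [TE TS Ts]] : exists T, [/\ T \subset [set:: s],
    forall S, #|T :&: S| <= r (S :&: [set:: s])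
    & forall i, #|T :&: [set:: take i s]| = r [set:: take i s]].
  have sT : [set:: s] = setT by apply/setP => e; rewrite !inE sE.
  exists T => //; apply/andP; split.
    by apply/forallP => S; have := TS S; rewrite sT setIT.
  by have := Ts (size s); rewrite take_size sT setIT => ->.
elim/last_ind: s us {sE} => [_|s e IHs].
  by exists set0; split=> [|S|i]; rewrite ?sub0set // set0I cards0 //.
rewrite rcons_uniq => /andP[es /IHs[T [TE TS Ts]]].
have seE : [set:: rcons s e] = e |: [set:: s].
  by apply/setP => f; rewrite !inE mem_rcons inE.
have eT : e \notin T by apply: contra es => /(subsetP TE); rewrite inE.
have TF : #|T| = r [set:: s].
  by have := Ts (size s); rewrite take_size (setIidPl TE).
have /andP[rle rle1] := r1 [set:: s] e.
case: (eqVneq (r [set:: s]) (r (e |: [set:: s]))) => [re|/eqP re].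
  exists T; split=> [|S|i].
  - by rewrite seE (subset_trans TE) // subsetUr.
  - rewrite (leq_trans (TS S)) // seE setIUr.
    case: (boolP (e \in S)) => [eS|eS].
      rewrite (setIidPr _ : S :&: [set e] = _) ?sub1set //.
      by have /andP[] := r1 (S :&: [set:: s]) e.
    suff -> : S :&: [set e] = set0 by rewrite set0U.
    by apply/setP => f; rewrite !inE; apply/negP => /andP[fS /eqP fe];
       rewrite -fe fS in eS.
  - have [ile|iles] := leqP i (size s).
      by rewrite -cats1 takel_cat // Ts.
    by rewrite take_oversize ?size_rcons // seE -re -TF (setIidPl _) //
      (subset_trans TE) // subsetUr.
have rlt : r (e |: [set:: s]) = (r [set:: s]).+1 by lia.
exists (e |: T); split=> [|S|i].
- by rewrite seE setUS.
- rewrite seE.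
  case: (boolP (e \in S)) => [eS|eS].
    rewrite [S :&: (_ |: _)]setIUr (setIidPr _ : S :&: [set e] = _) ?sub1set //.
    rewrite setIUl (setIidPl _ : [set e] :&: S = _) ?sub1set //.
    rewrite cardsU1 inE (negPf eT) /=.
    (* As [e] raises the rank of the whole prefix, it also raises that of the smaller set [S :&:
       [set:: s]]. *)
    have := rd (S :&: [set:: s]) [set:: s] e (subsetIr _ _).
    rewrite rlt addSn -addnS leq_add2l; exact: leq_ltn_trans (TS S).
  have e0 (A : {set E}) : (e |: A) :&: S = A :&: S.
    apply/setP => f; rewrite !inE; case: eqP => //= ->.
    by rewrite (negPf eS) !andbF.
  by rewrite e0 [S :&: _]setIC e0 [X in r X]setIC TS.
- have [ile|iles] := leqP i (size s).
    rewrite -cats1 takel_cat // -Ts; congr (#|pred_of_set _|).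
    apply/setP => f; rewrite !inE; case: eqP => //= ->.
    rewrite (negPf eT) andFb; apply/negP => /mem_take; exact/negP.
  rewrite take_oversize ?size_rcons // seE rlt -TF.
  by rewrite (setIidPl _) ?setUS // cardsU1 eT.
Qed.

End RankFunctions.

(** * Decomposing a point into pairs of bases *)

Section Decomposition.
Variables (R : realType) (E : finType).

Lemma weight_indicator (T F : {set E}) :
  weight (fun e => (e \in T)%:R : R) F = #|T :&: F|%:R.
Proof.
rewrite /weight -sum1_card natr_sum [RHS]big_mkcond /= big_mkcond /=.
by apply: eq_bigr => e _; rewrite !inE; do 2 case: (e \in _).
Qed.

Lemma weightE (x : E -> R) F : weight x F = \sum_e x e * (e \in F)%:R.
Proof.
rewrite /weight big_mkcond; apply: eq_bigr => e _.
by case: ifP; rewrite ?mulr1 ?mulr0.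
Qed.

(** Summation by parts: the nonnegative partial sums of [d] are multiplied by the decreases of [w]
    along [s]. *)
Lemma abel_ge0 (w d : E -> R) (s : seq E) :
  sorted (fun e f => w f <= w e) s ->
  (forall i, 0 <= \sum_(e <- take i s) d e) ->
  forall e0, w (last e0 s) * \sum_(e <- s) d e <= \sum_(e <- s) w e * d e.
Proof.
elim/last_ind: s => [|s e IHs] ss ds e0; first by rewrite !big_nil mulr0.
rewrite last_rcons !big_rcons /=.
have ds' i : 0 <= \sum_(e <- take i s) d e.
  have [ile|/ltnW iles] := leqP i (size s).
    by have := ds i; rewrite -cats1 takel_cat.
  rewrite take_oversize //.
  by have := ds (size s); rewrite -cats1 takel_cat // take_size.
have ss' : sorted (fun e f => w f <= w e) s.
  by move: ss; rewrite -cats1; case: (s) => //= f s'; rewrite cat_path => /andP[].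
have sd : 0 <= \sum_(e <- s) d e by have := ds' (size s); rewrite take_size.
have := IHs ss' ds' e0.
have : w e * \sum_(e <- s) d e <= w (last e0 s) * \sum_(e <- s) d e.
  case: (s) ss sd => [|f s'] ss sd; first by rewrite !big_nil !mulr0.
  apply: ler_wpM2r => //; move: ss.
  by rewrite /= rcons_path => /andP[].
lra.
Qed.

(* The greedy bases are simultaneously tight on all prefixes of the list of
   edges sorted by weight, hence beat x for every weight function. *)
Lemma rank_sum_decomposition (r1 r2 : {set E} -> nat) (a b : R) (x : E -> R) :
  rank_function r1 -> rank_function r2 -> 0 <= a -> 0 <= b ->
  (forall F, weight x F <= a * (r1 F)%:R + b * (r2 F)%:R) ->
  weight x setT = a * (r1 setT)%:R + b * (r2 setT)%:R ->
  exists c : {set E} * {set E} -> R,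
    let P p := base r1 p.1 && base r2 p.2 in
    [/\ forall p, 0 <= c p, \sum_(p | P p) c p = 1 & forall e,
     x e = \sum_(p | P p) c p * (a * (e \in p.1)%:R + b * (e \in p.2)%:R)].
Proof.
move=> rf1 rf2 a0 b0 xle xT; apply: convex_hull_separation => w t wt.
pose s := sort (fun e f => w f <= w e) (enum E).
have us : uniq s by rewrite sort_uniq enum_uniq.
have sE : s =i E by move=> e; rewrite mem_sort mem_enum.
have [T1 b1 g1] := greedy_base rf1 us sE.
have [T2 b2 g2] := greedy_base rf2 us sE.
have := wt (T1, T2); rewrite /= b1 b2 => /(_ isT); apply: le_trans.
rewrite -subr_ge0.
(* Over a prefix, [d] has nonnegative sum by the bound on [x] and the tightness of both bases; over
   all edges its sum is zero. *)
pose d e := a * (e \in T1)%:R + b * (e \in T2)%:R - x e.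
rewrite /dotf -sumrB.
under eq_bigr => e _ do rewrite -mulrBl -/(d e) mulrC.
have sumd (F : {set E}) : \sum_(e in F) d e =
    a * #|T1 :&: F|%:R + b * #|T2 :&: F|%:R - weight x F.
  by rewrite -!weight_indicator /weight !mulr_sumr -!big_split -sumrB.
have pref i : 0 <= \sum_(e <- take i s) d e.
  rewrite big_uniq ?take_uniq //=.
  rewrite (eq_bigl (fun e => e \in [set:: take i s])) => [|e]; last by rewrite /= inE.
  by rewrite sumd g1 g2 subr_ge0.
have tot : \sum_(e <- s) d e = 0.
  rewrite big_uniq //= (eq_bigl (fun e => e \in [set: E])) => [|e].
    move: b1 b2 => /andP[_ /eqP b1] /andP[_ /eqP b2].
    by rewrite sumd !setIT b1 b2 xT subrr.
  by rewrite sE !inE.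
rewrite (eq_bigl (fun e => e \in s)) => [|e]; last by rewrite sE.
rewrite -big_uniq //=.
case: (pickP (mem E)) => [e0 _|E0]; last first.
  have -> : s = [::] by apply/nilP; rewrite /nilp size_sort -cardE eq_card0.
  by rewrite big_nil.
have ss : sorted (fun e f => w f <= w e) s.
  by apply: sort_sorted => e f; exact: le_total.
by have := abel_ge0 ss pref e0; rewrite tot mulr0.
Qed.

End Decomposition.

(** * Components and rank functions *)

Lemma rank_function_le_card (E : finType) (r : {set E} -> nat) A :
  rank_function r -> (r A <= #|A|)%N.
Proof.
case=> r0 r1 _; have [n] := ubnP #|A|; elim: n A => // n IHn A An.
have [->|[e eA]] := set_0Vmem A; first by rewrite r0.
have := cardsD1 e A; rewrite eA => AD.
have := r1 (A :\ e) e; rewrite setD1K // => /andP[_].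
have := IHn (A :\ e); lia.
Qed.

(* Graphs as sets of pairs, so that a virtual edge can join any two vertices. *)
Section Components.
Variable V : finType.
Implicit Types (A B : {set V * V}) (u v w : V).
Local Open Scope nat_scope.

Definition adj A u v := ((u, v) \in A) || ((v, u) \in A).
Definition conn A := connect (adj A).
Definition cc A v := [set u | conn A v u].
Definition ncc A := #|cc A @: setT|.
Definition rk A := #|V| - ncc A.

Lemma conn_sym A u v : conn A u v = conn A v u.
Proof. by apply: sym_connect_sym => a b; rewrite /adj orbC. Qed.

Lemma conn0 A v : conn A v v.
Proof. exact: connect0. Qed.

Lemma conn_trans A u v w : conn A u v -> conn A v w -> conn A u w.
Proof. exact: connect_trans. Qed.

Lemma cc_eq A u v : (cc A u == cc A v) = conn A u v.
Proof.
apply/eqP/idP => [uv|uv]; first by have := conn0 A v;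
  rewrite -[conn A v v]in_set -/(cc A v) -uv inE.
apply/setP => w; rewrite !inE; apply: same_connect => //.
exact: conn_sym.
Qed.

Lemma conn_pair A p : p \in A -> conn A p.1 p.2.
Proof. by move=> pA; apply: connect1; rewrite /adj -surjective_pairing pA. Qed.

Lemma conn_const (T : eqType) (g : V -> T) A u v :
  (forall p, p \in A -> g p.1 = g p.2) -> conn A u v -> g u = g v.
Proof.
move=> gA /connectP[s]; elim: s u => [|w s IHs] u /=; first by move=> _ ->.
move=> /andP[uw ws] vE; rewrite -(IHs w ws vE).
by case/orP: uw => /gA.
Qed.

Lemma conn_sub A B u v :
  (forall p, p \in A -> conn B p.1 p.2) -> conn A u v -> conn B u v.
Proof.
by move=> AB uv; rewrite -cc_eq; apply/eqP; apply: conn_const uv => p /AB;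
   rewrite -cc_eq => /eqP.
Qed.

(** The singleton of each value of [g] is the image of a component under [g]. *)
Lemma ncc_ge (T : finType) (g : V -> T) A :
  (forall p, p \in A -> g p.1 = g p.2) -> #|g @: setT| <= ncc A.
Proof.
move=> gA; rewrite -(card_imset _ (@set1_inj T)).
suff -> : set1 @: (g @: setT) = (fun U : {set V} => g @: U) @: (cc A @: setT).
  exact: leq_imset_card.
rewrite -!imset_comp; apply: eq_imset => v /=; apply/setP => y; rewrite inE.
apply/eqP/imsetP => [->|[u]]; first by exists v; rewrite // inE conn0.
by rewrite inE => vu ->; rewrite -(conn_const gA vu).
Qed.

Lemma ncc_le_card A : ncc A <= #|V|.
Proof. by rewrite -cardsT leq_imset_card. Qed.

Lemma rk_ncc A : rk A + ncc A = #|V|.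
Proof. by rewrite subnK // ncc_le_card. Qed.

Lemma ncc_add A a b : ncc ((a, b) |: A) + ~~ conn A a b = ncc A.
Proof.
set A' := _ |: A.
have AA' p : p \in A -> cc A' p.1 = cc A' p.2.
  by move=> pA; apply/eqP; rewrite cc_eq conn_pair // inE pA orbT.
have ab' : cc A' a = cc A' b.
  by apply/eqP; rewrite cc_eq (@conn_pair _ (a, b)) // !inE eqxx.
have AA p : p \in A -> cc A p.1 = cc A p.2.
  by move=> pA; apply/eqP; rewrite cc_eq conn_pair.
case: (boolP (conn A a b)) => [ab|ab] /=; rewrite ?addn0.
  apply/eqP; rewrite eqn_leq !ncc_ge // => p /setU1P[->|/AA//].
  by apply/eqP; rewrite cc_eq.
apply/eqP; rewrite eqn_leq; apply/andP; split.
  (* [g] is constant on the components of [A] and separates the two that the new edge merges, so it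
     takes at least one value more than [cc A']. *)
  pose g v := (cc A' v, conn A a v).
  have gA p : p \in A -> g p.1 = g p.2.
    move=> pA; rewrite /g (AA' _ pA); congr (_, _).
    by rewrite -!cc_eq (AA _ pA).
  apply: leq_trans (ncc_ge gA).
  have ga : (cc A' a, false) \in g @: setT.
    by apply/imsetP; exists b; rewrite // /g ab' (negPf ab).
  rewrite (cardsD1 (cc A' a, false)) ga addnC leq_add2l.
  suff -> : ncc A' = #|fst @: (g @: setT :\ (cc A' a, false))|.
    exact: leq_imset_card.
  congr (#|pred_of_set _|); apply/setP => U; apply/imsetP/imsetP => [[v _ ->]|].
    case: (eqVneq (g v) (cc A' a, false)) => [[-> _]|gv].
      exists (cc A' a, true) => //; rewrite !inE xpair_eqE eqxx /=.
      by apply/imsetP; exists a; rewrite // /g conn0.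
    by exists (g v) => //; rewrite !inE gv imset_f.
  by case=> _ /setD1P[_ /imsetP[v _ ->]] ->; exists v.
pose g v := if conn A b v then cc A a else cc A v.
have gA p : p \in A' -> g p.1 = g p.2.
  rewrite /g => /setU1P[->|pA] /=.
    by rewrite conn0 if_same.
  by rewrite -!cc_eq (AA _ pA).
have cb : cc A b \in cc A @: setT by rewrite imset_f.
rewrite addn1 /ncc (cardsD1 (cc A b)) cb ltnS.
apply: leq_trans (ncc_ge gA); apply: subset_leq_card.
apply/subsetP => U /setD1P[Ub /imsetP[v _ vE]]; apply/imsetP; exists v => //.
by rewrite /g vE ifN // -cc_eq eq_sym -vE.
Qed.

Lemma rk_add A p : rk (p |: A) = rk A + ~~ conn A p.1 p.2.
Proof.
case: p => a b /=; have := ncc_add A a b.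
have := rk_ncc A; have := rk_ncc ((a, b) |: A).
move: (rk _) (rk A) (ncc _) (ncc A) => ? ? ? ?; case: conn => /=; lia.
Qed.

Lemma rk_le A B : (forall p, p \in A -> conn B p.1 p.2) -> rk A <= rk B.
Proof.
move=> AB; rewrite leq_sub2l // ncc_ge // => p /AB.
by rewrite -cc_eq => /eqP.
Qed.

Lemma rk_sub A B : A \subset B -> rk A <= rk B.
Proof. by move=> AB; apply: rk_le => p /(subsetP AB)/conn_pair. Qed.

Lemma conn_subset A B u v : A \subset B -> conn A u v -> conn B u v.
Proof. by move=> AB; apply: conn_sub => p /(subsetP AB)/conn_pair. Qed.

Lemma rk_rank_function : rank_function rk.
Proof.
split=> [|A p|A B p AB]; last 1 first.
- rewrite !rk_add; have := @conn_subset A B p.1 p.2 AB.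
  case: (conn A _ _) => [->//|_]; first by rewrite !addn0.
  by case: (conn B _ _) => /=; lia.
- have := @ncc_ge _ id set0; rewrite imset_id cardsT => H.
  by apply/eqP; rewrite subn_eq0 H // => p; rewrite inE.
- by rewrite rk_add; case: conn => /=; lia.
Qed.

(** The vertices outside [U] are isolated, and inside [U] there is at least one component for each
    value of [f]. *)
Lemma rk_bound (T : finType) (f : V -> T) (U : {set V}) A :
  (forall p, p \in A -> [/\ p.1 \in U, p.2 \in U & f p.1 = f p.2]) ->
  rk A + #|f @: U| <= #|U|.
Proof.
move=> fA; pose g v : V + T := if v \in U then inr (f v) else inl v.
have gA p : p \in A -> g p.1 = g p.2.
  by rewrite /g => /fA[-> -> ->].
have := ncc_ge gA.
have : #|~: U| + #|f @: U| <= #|g @: setT|.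
  rewrite -(card_imset _ (inl_inj : injective (@inl V T))).
  rewrite -(card_imset (f @: U) (inr_inj : injective (@inr V T))).
  rewrite -cardsUI [_ :&: _](_ : _ = set0).
    rewrite cards0 addn0; apply: subset_leq_card; apply/subsetP => y.
    case/setUP => [/imsetP[v vU ->]|/imsetP[_ /imsetP[v vU ->] ->]];
      apply/imsetP; exists v => //; rewrite /g.
      by rewrite ifN // -in_setC.
    by rewrite vU.
  by apply/setP => y; rewrite !inE; apply/negP => /andP[/imsetP[? _ ->]]/imsetP[].
have := rk_ncc A; have := cardsC U; lia.
Qed.

End Components.

(** * The graphic rank of edge sets *)

Section EdgeRank.
Variables (V E : finType) (ends : E -> V * V).
Implicit Types (F G : {set E}) (U : {set V}).

Definition erk F := rk (ends @: F).

Lemma erk_rank_function : rank_function erk.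
Proof.
have [r0 r1 rd] := @rk_rank_function V; split=> [|F e|F G e FG].
- by rewrite /erk imset0.
- by rewrite /erk imsetU1.
- by rewrite /erk !imsetU1 rd // imsetS.
Qed.

Lemma mem_induced U e :
  (e \in induced_edges ends U) = ((ends e).1 \in U) && ((ends e).2 \in U).
Proof. by rewrite inE orbb. Qed.

Lemma erk_induced_le U F : U != set0 -> F \subset induced_edges ends U ->
  (erk F < #|U|)%N.
Proof.
move=> U0 FU; have := @rk_bound _ unit (fun=> tt) U (ends @: F).
have -> : (fun=> tt) @: U = [set tt].
  apply/setP => -[]; rewrite inE eqxx; apply/imsetP.
  by have [v vU] := set0Pn _ U0; exists v.
rewrite cards1 addn1; apply=> p /imsetP[e /(subsetP FU)].
by rewrite mem_induced => /andP[? ?] ->.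
Qed.

Variable (R : realType).

Lemma le_weight (x : E -> R) F G : (forall e, 0 <= x e) ->
  F \subset G -> weight x F <= weight x G.
Proof.
move=> x0 FG; rewrite !weightE; apply: ler_sum => e _.
rewrite ler_wpM2l // ler_nat.
by case: (boolP (e \in F)) => // /(subsetP FG) ->.
Qed.

(** The edges of [F] split among its components [U]; the bounds [mu * (#|U|%:R - 1)] sum to [mu]
    times the graphic rank. *)
Lemma weight_le_erk (mu : R) (x : E -> R) F : (forall e, 0 <= x e) ->
  (forall U, U != set0 ->
     weight x (induced_edges ends U) <= mu * (#|U|%:R - 1)) ->
  weight x F <= mu * (erk F)%:R.
Proof.
move=> x0 xU; set A := ends @: F.
pose K := cc A @: setT.
rewrite /weight (partition_big (fun e => cc A (ends e).1) (mem K)) /=; last first.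
  by move=> e _; rewrite imset_f.
have -> : mu * (erk F)%:R = \sum_(U in K) mu * (#|U|%:R - 1).
  rewrite -mulr_sumr sumrB sumr_const -natr_sum; congr (_ * _).
  have -> : (\sum_(U in K) #|U| = #|V|)%N.
    rewrite -sum1_card (partition_big (cc A) (mem K)) /=; last first.
      by move=> v _; rewrite imset_f.
    apply: eq_bigr => _ /imsetP[v _ ->]; rewrite -sum1_card; apply: eq_bigl => u.
    by rewrite inE cc_eq conn_sym.
  by rewrite -(rk_ncc A) natrD addrK.
apply: ler_sum => _ /imsetP[v _ ->].
have vU : cc A v != set0 by apply/set0Pn; exists v; rewrite inE conn0.
apply: le_trans (xU _ vU).
rewrite [leLHS](_ : _ =
  weight x [set e in F | cc A (ends e).1 == cc A v]); last first.
  by apply: eq_bigl => e; rewrite inE.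
apply: le_weight => //; apply/subsetP => e; rewrite inE => /andP[eF].
rewrite cc_eq mem_induced !inE conn_sym => ve; rewrite ve /=.
exact: conn_trans ve (conn_pair (imset_f ends eF)).
Qed.

End EdgeRank.

(** * The rank function of the Gao-tree matroid *)

Section LayeredRank.
Variables (V E : finType) (ends : E -> V * V) (lev : V -> nat) (K : nat).
Hypothesis levK : forall v, (lev v <= K)%N.
Implicit Types (F G : {set E}) (U : {set V}).
Local Open Scope nat_scope.

Definition low_level e := minn (lev (ends e).1) (lev (ends e).2).
Definition high_level e := maxn (lev (ends e).1) (lev (ends e).2).

Definition inner := [set e | low_level e == high_level e].
Definition hits_level (e : E) (t : nat) := (low_level e == t) && (high_level e == t.+1).
Definition hit_level F t := [exists e in F, hits_level e t].
Definition nhit F := \sum_(t < K) hit_level F t.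
(** The graphic matroids of the levels contribute the first term, the rank one matroids between
    consecutive levels the second. Edges that skip a level are loops. *)
Definition lrk F := erk ends (F :&: inner) + nhit F.

Lemma innerP e : (e \in inner) = (lev (ends e).1 == lev (ends e).2).
Proof. rewrite inE /low_level /high_level; lia. Qed.

Lemma hitU1 e F t : hit_level (e |: F) t = hits_level e t || hit_level F t.
Proof.
apply/existsP/orP => [[f]|[et|/existsP[f /andP[fF ft]]]].
- rewrite !inE => /andP[/orP[/eqP ->|fF] ft]; [by left|right].
  by apply/existsP; exists f; rewrite fF.
- by exists e; rewrite !inE eqxx et.
- by exists f; rewrite !inE fF orbT ft.
Qed.

Lemma hit_sub F G t : F \subset G -> hit_level F t -> hit_level G t.
Proof.
move=> FG /existsP[e /andP[/(subsetP FG) eG et]].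
by apply/existsP; exists e; rewrite eG et.
Qed.

Lemma sum_eq_le1 (m : nat) : \sum_(t < K) (t == m :> nat) <= 1.
Proof.
case: (ltnP m K) => mK; last first.
  by rewrite big1 // => t _; have := ltn_ord t; lia.
rewrite (bigD1 (Ordinal mK)) //= eqxx big1 // => t /eqP tm.
by case: eqP => // tm'; case: tm; apply: val_inj.
Qed.

Lemma nhit_le1 F m : (forall e t, e \in F -> hits_level e t -> t = m) -> nhit F <= 1.
Proof.
move=> Fm; apply: leq_trans (sum_eq_le1 m); apply: leq_sum => t _.
case: (boolP (hit_level F t)) => // /existsP[e /andP[eF et]].
by rewrite (Fm _ _ eF et) eqxx.
Qed.

Lemma lrk_rank_function : rank_function lrk.
Proof.
have [r0 r1 rd] := erk_rank_function ends; split=> [|F e|F G e FG].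
- rewrite /lrk set0I r0 /nhit big1 // => t _.
  by apply/eqP; rewrite eqb0; apply/existsP => -[e]; rewrite inE.
- rewrite /lrk setIUl; case: (boolP (e \in inner)) => eI.
    rewrite (setIidPl _ : [set e] :&: inner = _) ?sub1set //.
    rewrite [nhit (e |: F)](_ : _ = nhit F).
      by have := r1 (F :&: inner) e; lia.
    apply: eq_bigr => t _; rewrite hitU1; congr nat_of_bool.
    by move: eI; rewrite inE /hits_level; case: hit_level; lia.
  have -> : [set e] :&: inner = set0.
    by apply/setP => f; rewrite !inE; case: eqP => //= ->;
       apply/negbTE; move: eI; rewrite inE.
  rewrite set0U -addnS !leq_add2l; apply/andP; split.
    by apply: leq_sum => t _; rewrite hitU1; case: hit_level; rewrite ?orbT.
  rewrite -addn1; apply: (@leq_trans (nhit F + \sum_(t < K) (t == low_level e :> nat))).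
    rewrite /nhit -big_split; apply: leq_sum => t _; rewrite hitU1 /hits_level.
    rewrite [_ == low_level e]eq_sym.
    by case: hit_level; case: (low_level e == t) => //=; case: (high_level e == _).
  by rewrite leq_add2l sum_eq_le1.
- rewrite /lrk.
  have h : nhit (e |: G) + nhit F <= nhit G + nhit (e |: F).
    rewrite /nhit -!big_split; apply: leq_sum => t _ /=; rewrite !hitU1.
    have := @hit_sub F G t FG.
    by case: (hit_level F t) => [->//|_]; case: (hit_level G t); case: (hits_level e t).
  have := setSI inner FG; move=> FGI.
  have : erk ends ((e |: G) :&: inner) + erk ends (F :&: inner) <=
         erk ends (G :&: inner) + erk ends ((e |: F) :&: inner).
    rewrite !setIUl; case: (boolP (e \in inner)) => eI.
      by rewrite (setIidPl _ : [set e] :&: inner = _) ?sub1set // rd.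
    have -> : [set e] :&: inner = set0.
      by apply/setP => f; rewrite !inE; case: eqP => //= ->;
         apply/negbTE; move: eI; rewrite inE.
    by rewrite !set0U.
  lia.
Qed.

(** Inner edges preserve the level, so inside [U] their rank is at most [#|U|] minus the number of
    levels that [U] meets; the hits are fewer than these levels. *)
Lemma lrk_induced_le U : U != set0 -> lrk (induced_edges ends U) < #|U|.
Proof.
move=> U0; pose f v : 'I_K.+1 := inord (lev v).
have fE v : f v = lev v :> nat by rewrite inordK // ltnS.
have := @rk_bound _ _ f U (ends @: (induced_edges ends U :&: inner)).
have /[swap] /[apply] : forall p,
    p \in ends @: (induced_edges ends U :&: inner) ->
    [/\ p.1 \in U, p.2 \in U & f p.1 = f p.2].
  move=> p /imsetP[e /setIP[]]; rewrite mem_induced innerP => /andP[e1 e2].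
  by move=> /eqP e12 ->; split=> //; apply: val_inj; rewrite /= !fE.
suff : nhit (induced_edges ends U) < #|f @: U| by rewrite /lrk /erk; lia.
(* The least level of U is not the upper level of a hit. *)
have [v0 v0U] := set0Pn _ U0.
case: (arg_minnP lev v0U) => v vU vmin.
rewrite (cardsD1 (f v)) imset_f // add1n ltnS.
(* [lift ord0] charges a hit between levels [t] and [t + 1] to level [t + 1]. *)
have -> : nhit (induced_edges ends U) =
    #|lift ord0 @: [set t : 'I_K | hit_level (induced_edges ends U) t]|.
  rewrite card_imset; last exact: lift_inj.
  rewrite -sum1_card [RHS]big_mkcond; apply: eq_bigr => t _.
  by rewrite inE; case: hit_level.
apply: subset_leq_card; apply/subsetP => _ /imsetP[t + ->].
rewrite inE => /existsP[e /andP[]]; rewrite mem_induced => /andP[e1 e2].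
rewrite /hits_level /low_level /high_level => /andP[/eqP lot /eqP hit].
have vt : lev v <= t by rewrite -lot leq_min !vmin.
have [w wU wt] : exists2 w, w \in U & lev w = t.+1.
  have [e12|/ltnW e12] := leqP (lev (ends e).1) (lev (ends e).2).
    by exists (ends e).2; rewrite // -hit (maxn_idPr e12).
  by exists (ends e).1; rewrite // -hit (maxn_idPl e12).
rewrite !inE; apply/andP; split.
  by apply/eqP => /(congr1 (@nat_of_ord _)); rewrite lift0 fE => tv;
     rewrite -tv ltnn in vt.
by apply/imsetP; exists w => //; apply: ord_inj; rewrite lift0 fE wt.
Qed.

End LayeredRank.

(** * Components of an edge set across the levels *)

Section LayeredGraph.
Variables (V E : finType) (ends : E -> V * V) (lev : V -> nat) (K : nat).
Hypothesis levK : forall v, (lev v <= K)%N.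
Variable F : {set E}.
Local Open Scope nat_scope.

Local Notation A := (ends @: F).
Local Notation I := (inner ends lev).
Local Notation lo := (low_level ends lev).
Local Notation hi := (high_level ends lev).
Local Notation hits := (hits_level ends lev).
Local Notation hit := (hit_level ends lev).

(** Over all [t], these sets enumerate the pairs of a component of [F] and a level that it meets
    other than its lowest. *)
Definition rising t := [set cc A v | v in
  [set v | (lev v == t.+1) && [exists u, conn A v u && (lev u <= t)]]].
Definition rho t := #|rising t|.
(** At a good [t] the terms [lam * hit] and [(mu - lam) * rho] add up to [mu], the price of one unit
    of graphic rank. *)
Definition good t := hit F t && (rho t == 1).

(** The edges charged to [t]: as their component must meet level [t + 1], it belongs to
    [rising t]. *)
Definition crossing t := [set e in F | (lo e <= t < hi e)
  && [exists v, conn A (ends e).1 v && (lev v == t.+1)]].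

Lemma mem_rising t u v : conn A v u -> lev v = t.+1 -> lev u <= t ->
  cc A v \in rising t.
Proof.
move=> vu vt ut; apply/imsetP; exists v => //; rewrite inE vt eqxx /=.
by apply/existsP; exists u; rewrite vu.
Qed.

Lemma lo_end e : e \in F -> exists2 u, conn A (ends e).1 u & lev u = lo e.
Proof.
move=> eF.
have [e12|/ltnW e12] := leqP (lev (ends e).1) (lev (ends e).2).
  by exists (ends e).1; [exact: conn0|rewrite /low_level (minn_idPl e12)].
by exists (ends e).2; [exact/conn_pair/imset_f|rewrite /low_level (minn_idPr e12)].
Qed.

Lemma hi_end e : e \in F -> exists2 u, conn A (ends e).1 u & lev u = hi e.
Proof.
move=> eF.
have [e12|/ltnW e12] := leqP (lev (ends e).1) (lev (ends e).2).
  by exists (ends e).2; [exact/conn_pair/imset_f|rewrite /high_level (maxn_idPr e12)].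
by exists (ends e).1; [exact: conn0|rewrite /high_level (maxn_idPl e12)].
Qed.

Lemma hi_le_K e : hi e <= K.
Proof. by rewrite geq_max !levK. Qed.

(** The pairs of a component and a level that it meets are at most as many as the components of the
    inner edges. Each component has one pair with its lowest level; the sum of [rho] counts the
    others. *)
Lemma sum_rho : \sum_(t < K) rho t + erk ends (F :&: I) <= erk ends F.
Proof.
pose f v : 'I_K.+1 := inord (lev v).
have fE v : f v = lev v :> nat by rewrite inordK // ltnS.
pose g v := (cc A v, f v).
have gA p : p \in ends @: (F :&: I) -> g p.1 = g p.2.
  move=> /imsetP[e /setIP[eF]]; rewrite innerP => /eqP lev12 ->.
  rewrite /g; congr (_, _); last by apply: ord_inj; rewrite !fE.
  by apply/eqP; rewrite cc_eq conn_pair // imset_f.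
have gle := ncc_ge gA.
(* [low] collects the pairs in which the component has a vertex below the level. *)
pose low := [set p : {set V} * 'I_K.+1 | [exists u, (u \in p.1) && (lev u < p.2)]].
have lowK : #|fst @: ((g @: setT) :\: low)| >= ncc A.
  apply: subset_leq_card; apply/subsetP => _ /imsetP[v _ ->].
  have vv : v \in cc A v by rewrite inE conn0.
  case: (@arg_minnP _ v (fun w => w \in cc A v) lev vv) => w + wmin.
  rewrite inE => vw.
  apply/imsetP; exists (g w); last by apply/eqP; rewrite cc_eq.
  rewrite inE imset_f // andbT inE; apply/existsP => -[u /=].
  have -> : cc A w = cc A v by apply/eqP; rewrite cc_eq conn_sym.
  by move=> /andP[/wmin]; rewrite fE; lia.
have rhoK : \sum_(t < K) rho t <= #|(g @: setT) :&: low|.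
  rewrite -[X in _ <= X]sum1_card (partition_big snd xpredT) //=.
  (* Level 0 is split off, since [rho t] counts pairs at level [t + 1]. *)
  rewrite big_ord_recl /= (leq_trans _ (leq_addl _ _)) //.
  apply: leq_sum => t _; rewrite sum1dep_card.
  apply: leq_trans (leq_imset_card fst _); apply: subset_leq_card.
  apply/subsetP => _ /imsetP[v + ->].
  rewrite inE => /andP[/eqP vt /existsP[u /andP[vu ut]]].
  apply/imsetP; exists (g v) => //.
  rewrite !inE imset_f //= -val_eqE /= fE vt eqxx andbT.
  by apply/existsP; exists u; rewrite inE vu.
have := leq_imset_card fst ((g @: setT) :\: low).
have := cardsID low (g @: setT).
have := rk_ncc A; have := rk_ncc (ends @: (F :&: I)); rewrite /erk.
move: lowK rhoK gle.
move: (rk _) (rk A) (ncc _) (ncc A) (\sum_(t < K) _) => ? ? ? ? ?.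
move: #|_| #|_ :\: _| #|_ :&: _| #|_ @: _| #|V| => *; lia.
Qed.

Lemma hits_ends e t : hits e t -> exists p q, [/\ lev p = t, lev q = t.+1
  & forall B : {set V * V}, ends e \in B -> conn B (ends e).1 p /\ conn B (ends e).1 q].
Proof.
move=> /andP[/eqP lot /eqP hit].
have [e12|/ltnW e12] := leqP (lev (ends e).1) (lev (ends e).2).
  exists (ends e).1, (ends e).2; rewrite -hit -lot /low_level /high_level (minn_idPl e12).
  by rewrite (maxn_idPr e12); split=> // B eB; rewrite conn0 conn_pair.
exists (ends e).2, (ends e).1; rewrite -hit -lot /low_level /high_level (minn_idPr e12).
by rewrite (maxn_idPl e12); split=> // B eB; rewrite conn0 conn_pair.
Qed.

(** Just one component rises through a good level, and both that of [v] and that of [e] do. *)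
Lemma good_conn t u v e : good t -> conn A v u -> lev v = t.+1 ->
  lev u <= t -> e \in F -> hits e t -> conn A v (ends e).1.
Proof.
move=> /andP[_ /cards1P[U risingU]] vu vt ut eF /hits_ends[p [q [pt qt pq]]].
have [ep eq] := pq A (imset_f ends eF).
have := mem_rising vu vt ut; rewrite risingU inE => /eqP vU.
have qp : conn A q p by apply: conn_trans ep; rewrite conn_sym.
have := mem_rising qp qt; rewrite pt => /(_ (leqnn t)).
rewrite risingU inE -vU cc_eq => qv.
by rewrite conn_sym; exact: conn_trans eq qv.
Qed.

(** At each good level passed, the component contains the hitting edge, whose lower end leads one
    level down. *)
Lemma good_descend d t u v : conn A u v -> lev v = d -> lev u <= t <= d ->
  (forall s, t <= s < d -> good s) -> exists2 w, conn A u w & lev w = t.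
Proof.
elim: d v => [|d IHd] v uv vd utd gd; first by exists v; [|lia].
have [td|td] := eqVneq t d.+1; first by exists v; [|lia].
have gdd : good d by apply: gd; lia.
have /andP[/existsP[e /andP[eF ed]] _] := gdd.
have vu : conn A v u by rewrite conn_sym.
have ve : conn A v (ends e).1 by apply: good_conn gdd vu vd _ eF ed; lia.
have [p [q [pd _ /(_ A (imset_f ends eF))[ep _]]]] := hits_ends ed.
apply: (IHd p) => //; last by move=> s sd; apply: gd; lia.
  by apply: conn_trans uv (conn_trans ve ep).
by lia.
Qed.

Hypothesis same_level_conn : forall u v, lev u = lev v -> conn A u v ->
  conn (ends @: (F :&: I)) u v.

(** One hitting edge for each good level; with the inner edges of [F], these span all good edges. *)
Definition rep t := [pick e in F | hits e t].
Definition reps := [set e | [exists t : 'I_K, good t && (rep t == Some e)]].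

Lemma card_reps : #|reps| <= \sum_(t < K) good t.
Proof.
rewrite -(card_imset _ (@Some_inj _ : injective (@Some E))).
have -> : \sum_(t < K) good t = #|[set t : 'I_K | good t]|.
  rewrite -sum1_card [RHS]big_mkcond; apply: eq_bigr => t _.
  by rewrite inE; case: good.
apply: leq_trans (leq_imset_card (fun t : 'I_K => rep t) _); apply: subset_leq_card.
apply/subsetP => _ /imsetP[e + ->]; rewrite inE => /existsP[t /andP[gt /eqP re]].
by apply/imsetP; exists t; rewrite ?inE // re.
Qed.

(** Induction on the level of [v]: the component crosses each good level by its representative, and
    its vertices on one level are joined by inner edges. *)
Lemma good_ascend d u v : conn A u v -> lev v = d -> lev u <= d ->
  (forall s, lev u <= s < d -> good s) ->
  conn (ends @: (F :&: I :|: reps)) u v.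
Proof.
set B := ends @: (_ :|: _).
have IB a b : conn (ends @: (F :&: I)) a b -> conn B a b.
  by apply: conn_subset; exact: imsetS (subsetUl _ _).
elim: d v => [|d IHd] v uv vd ud gd.
  by apply/IB/same_level_conn => //; lia.
have [udE|udE] := eqVneq (lev u) d.+1.
  by apply/IB/same_level_conn => //; lia.
have gdd : good d by apply: gd; lia.
have /andP[/existsP[e0 e0d] _] := gdd.
have dK : d < K by have := levK v; lia.
have [e re] : exists e, rep d = Some e.
  by rewrite /rep; case: pickP => [e _|/(_ e0)]; [exists e|rewrite e0d].
have /andP[eF ed] : (e \in F) && hits e d.
  by move: re; rewrite /rep; case: pickP => // e' e'd [<-].
have eB : ends e \in B.
  apply: imset_f; rewrite inE; apply/orP; right; rewrite inE.
  by apply/existsP; exists (Ordinal dK); rewrite /= gdd re eqxx.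
have vu : conn A v u by rewrite conn_sym.
have ve : conn A v (ends e).1 by apply: good_conn gdd vu vd _ eF ed; lia.
have [p [q [pd qd pq]]] := hits_ends ed.
have [ep eq] := pq A (imset_f ends eF); have [epB eqB] := pq B eB.
have up : conn B u p.
  have uvp : conn A u p by apply: conn_trans uv (conn_trans ve ep).
  apply: (IHd p uvp pd) => [|s sd]; first by clear -ud udE; lia.
  by apply: gd; clear -sd; lia.
have qvB : conn B q v.
  apply/IB/same_level_conn; first by rewrite vd.
  by rewrite conn_sym; apply: conn_trans ve eq.
apply: conn_trans up (conn_trans _ (conn_trans eqB qvB)).
by rewrite conn_sym.
Qed.

(** The inner edges of [F] cross no level and belong to this set. *)
Definition good_edges :=
  [set e in F | [forall t : 'I_K, (lo e <= t < hi e) ==> good t]].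

Lemma erk_good_edges :
  erk ends good_edges <= erk ends (F :&: I) + \sum_(t < K) good t.
Proof.
have [r0 _ rd] := erk_rank_function ends.
have := submodular (F :&: I) reps rd.
have := rank_function_le_card reps (erk_rank_function ends).
have := card_reps.
have : erk ends good_edges <= erk ends (F :&: I :|: reps); last by lia.
apply: rk_le => _ /imsetP[e + ->]; rewrite inE => /andP[eF /forallP eg].
have eg' s : lo e <= s < hi e -> good s.
  move=> es; have sK : s < K by have := hi_le_K e; lia.
  by have /implyP := eg (Ordinal sK); apply.
have ee : conn A (ends e).1 (ends e).2 by rewrite conn_pair // imset_f.
have [e12|e12] := leqP (lev (ends e).1) (lev (ends e).2).
  apply: (good_ascend ee erefl e12) => s es; apply: eg'.
  by rewrite /low_level /high_level (minn_idPl e12) (maxn_idPr e12).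
rewrite conn_sym; apply: (good_ascend _ erefl (ltnW e12)) => [|s es].
  by rewrite conn_sym.
apply: eg'.
by rewrite /low_level /high_level (minn_idPr (ltnW e12)) (maxn_idPl (ltnW e12)).
Qed.

(* A bad edge is charged to the last bad level it crosses: the levels above
   being good, its component descends to that level. *)
Lemma bad_edge e : e \in F -> e \notin good_edges ->
  exists2 t : 'I_K, ~~ good t & e \in crossing t.
Proof.
move=> eF; rewrite inE eF /= negb_forall => /existsP[t0].
rewrite negb_imply => t0P.
pose P (t : 'I_K) := (lo e <= t < hi e) && ~~ good t.
case: (@arg_maxnP _ t0 P (@nat_of_ord K) t0P) => t /andP[te gt] tmax.
exists t => //; rewrite inE eF te /=.
have [u eu ulo] := lo_end eF; have [v ev vhi] := hi_end eF.
have uv : conn A u v by apply: conn_trans ev; rewrite conn_sym.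
have [||w uw wt] := @good_descend (hi e) t.+1 u v uv vhi; [lia| |].
  move=> s sP; apply/negPn/negP => gs.
  have sK : s < K by have := hi_le_K e; lia.
  by have := tmax (Ordinal sK); rewrite /P /= gs; lia.
by apply/existsP; exists w; rewrite wt eqxx andbT; apply: conn_trans eu uw.
Qed.

End LayeredGraph.

(** * The rank inequality *)

Section RankInequality.
Variables (R : realType) (V E : finType) (ends : E -> V * V).
Variables (lev : V -> nat) (K : nat) (x : E -> R) (mu lam : R).
Hypothesis levK : forall v, (lev v <= K)%N.
Hypothesis x_ge0 : forall e, 0 <= x e.
Hypothesis xU : forall U : {set V}, U != set0 ->
  weight x (induced_edges ends U) <= mu * (#|U|%:R - 1).
Hypotheses (lam_gt0 : 0 < lam) (lam_le : lam <= mu).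

Local Notation lo := (low_level ends lev).
Local Notation hi := (high_level ends lev).
Local Notation lev_in a b := [set v | (a <= lev v < b)%N].

Hypothesis xcut : forall t, (t < K)%N ->
  weight x [set e | (lo e <= t < hi e)%N] <= 2 * mu - lam.
Hypothesis xskip : forall t, (0 < t < K)%N ->
  weight x [set e | (lo e < t < hi e)%N] <= mu - lam.
Hypothesis xlevels : forall a b, (a < b <= K.+1)%N ->
  mu * #|lev_in a b|%:R - 2 * mu + lam
    <= weight x (induced_edges ends (lev_in a b)).

Local Notation r1 := (lrk ends lev K).
Local Notation r := (erk ends).

Definition violates F := lam * (r1 F)%:R + (mu - lam) * (r F)%:R < weight x F.

Lemma weightUI (y : E -> R) F G :
  weight y (F :|: G) + weight y (F :&: G) = weight y F + weight y G.
Proof.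
rewrite !weightE -!big_split; apply: eq_bigr => e _ /=; rewrite !inE.
by case: (e \in F); case: (e \in G); rewrite /=; lra.
Qed.

(** The gains 1 in [r1] and 2 in [r] are worth [lam + 2 * (mu - lam) = 2 * mu - lam], exactly the
    deficit allowed by [xlevels]. *)
Let augment_arith (w w' wI wD L L' e e' d m : R) :
  mu * m - 2 * mu + lam <= wI -> w' + wD = w + wI -> wD <= mu * d ->
  L' + d + 1 <= L + m -> e' + d + 2 <= e + m ->
  lam * L + (mu - lam) * e < w -> lam * L' + (mu - lam) * e' < w'.
Proof.
move=> h1 h2 h3; rewrite -subr_ge0 => h4; rewrite -subr_ge0 => h5 h6.
have := mulr_ge0 (ltW lam_gt0) h4.
have lm : 0 <= mu - lam by rewrite subr_ge0.
have := mulr_ge0 lm h5; lra.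
Qed.

Let deficit_arith (w d m : R) :
  w <= mu * d -> d + 2 <= m -> w < mu * m - 2 * mu + lam.
Proof.
move=> h2; rewrite -subr_ge0 => h3.
have mu0 : 0 <= mu by apply: le_trans lam_le; exact: ltW.
have := mulr_ge0 mu0 h3; move: lam_gt0; lra.
Qed.

(* The pair (u, v) acts as a virtual edge, spanned by F but not by the part of
   F inside the levels; it makes the submodular inequality strict. *)
Lemma augment F a b u v (M := lev_in a b) (D := F :&: induced_edges ends M) :
  (a < b <= K.+1)%N -> D \subset inner ends lev -> u \in M -> v \in M ->
  conn (ends @: F) u v -> ~~ conn (ends @: D) u v ->
  violates F ->
  violates (F :|: induced_edges ends M) /\
  F \proper F :|: induced_edges ends M.
Proof.
move=> ab DI uM vM uvF uvD Fviol.
set I := induced_edges ends M in D DI uvD *.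
have M0 : M != set0 by apply/set0Pn; exists u.
have xI := xlevels ab; rewrite -/M -/I in xI.
have [_ _ r1d] := lrk_rank_function ends lev K.
have [_ _ rkd] := @rk_rank_function V.
have qI : (rk ((u, v) |: ends @: I) < #|M|)%N.
  have := @rk_bound _ unit (fun=> tt) M ((u, v) |: ends @: I).
  have -> : (fun=> tt) @: M = [set tt].
    by apply/setP => -[]; rewrite inE eqxx; apply/imsetP; exists u.
  rewrite cards1 addn1; apply=> p /setU1P[->//|/imsetP[e]].
  by rewrite mem_induced => /andP[? ?] ->.
have rD : r D = rk (ends @: D) by [].
have sub1 : (r1 (F :|: I) + r D < r1 F + #|M|)%N.
  have := submodular F I r1d; have := lrk_induced_le ends levK M0.
  rewrite -/I -/D; have : (r D <= r1 D)%N; last by lia.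
  by rewrite /lrk (setIidPl DI) leq_addr.
have sub2 : (r (F :|: I) + (r D).+1 < r F + #|M|)%N.
  have := submodular ((u, v) |: ends @: F) ((u, v) |: ends @: I) rkd.
  have : (rk ((u, v) |: ends @: D) <=
          rk (((u, v) |: ends @: F) :&: ((u, v) |: ends @: I)))%N.
    apply: rk_sub; rewrite subsetI !setUS ?imsetS ?subsetIl ?subsetIr //.
  have : (r (F :|: I) <= rk (((u, v) |: ends @: F) :|: ((u, v) |: ends @: I)))%N.
    by apply: rk_sub; rewrite imsetU setUSS // subsetUr.
  move: qI; rewrite !rk_add /= uvF uvD addn0 addn1 -rD -/(r F).
  clear; lia.
have rel := weightUI x F I; rewrite -/D in rel.
have wD := weight_le_erk D x_ge0 xU.
split.
  move: Fviol; rewrite /violates.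
  have {}sub1 : (r1 (F :|: I))%:R + (r D)%:R + 1 <= (r1 F)%:R + #|M|%:R :> R.
    by rewrite -!natrD natr1 ler_nat.
  have {}sub2 : (r (F :|: I))%:R + (r D)%:R + 2 <= (r F)%:R + #|M|%:R :> R.
    by rewrite -!natrD ler_nat; move: sub2; clear; lia.
  exact: augment_arith xI rel wD sub1 sub2.
(* If [F] contained all edges inside [M], these would not span the virtual edge, and their rank
   would be too small for their weight. *)
rewrite properE subsetUl subUset subxx /=; apply/negP => IF.
have DE : D = I by apply/setIidPr.
move: xI; apply/negP; rewrite -ltNge.
apply: deficit_arith (weight_le_erk I x_ge0 xU) _.
rewrite -natrD ler_nat; move: qI uvD; rewrite rk_add DE /= => + uvI.
by rewrite uvI addn1 addn2.
Qed.

Section MaximalViolator.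
Variable F : {set E}.
Local Notation A := (ends @: F).
Local Notation Iset := (inner ends lev).
Hypothesis same_level_conn : forall u v, lev u = lev v -> conn A u v ->
  conn (ends @: (F :&: Iset)) u v.
Hypothesis next_level_hit : forall u v, lev v = (lev u).+1 -> conn A u v ->
  hit_level ends lev F (lev u).

Local Notation rho := (rho ends lev F).
Local Notation good := (good ends lev F).
Local Notation hit := (hit_level ends lev F).

(** If a bad level has a charged edge, either it is hit and has at least two rising components,
    which pay for the cut bound [2 * mu - lam], or it is not hit, so all charged edges skip level
    [t] and weigh at most [mu - lam]. *)
Lemma crossing_weight (t : 'I_K) : ~~ good t ->
  weight x (crossing ends lev F t) <=
    lam * (hit t)%:R + (mu - lam) * (rho t)%:R.
Proof.
have lm : 0 <= mu - lam by rewrite subr_ge0.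
have rho_gt0 e : e \in crossing ends lev F t -> (0 < rho t)%N.
  rewrite inE => /and3P[eF /andP[lot _] /existsP[v /andP[ev /eqP vt]]].
  have [u eu ulo] := lo_end ends lev eF.
  have vu : conn A v u by apply: conn_trans eu; rewrite conn_sym.
  rewrite card_gt0; apply/set0Pn; exists (cc A v).
  by apply: mem_rising vu vt _; rewrite ulo.
have [c0|[e0 e0t]] := set_0Vmem (crossing ends lev F t).
  move=> _; rewrite c0 /weight big_set0 addr_ge0 // mulr_ge0 // ?ler0n //.
  exact: ltW.
have rho0 := rho_gt0 _ e0t.
rewrite /good /=; case: (boolP (hit t)) => [ht /=|ht _] /=.
  move=> rho1; have rho2 : (2 <= rho t)%N.
    by move: rho0 rho1; case: (rho t) => [|[]].
  apply: (@le_trans _ _ (2 * mu - lam)).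
    apply: le_trans (xcut (ltn_ord t)); apply: le_weight => //.
    by apply/subsetP => e; rewrite !inE => /and3P[].
  have : 2 <= (rho t)%:R :> R by rewrite ler_nat.
  rewrite -subr_ge0 => /(mulr_ge0 lm); lra.
apply: (@le_trans _ _ (mu - lam)); last first.
  rewrite mulr0 add0r ler_peMr // -[1]/(1%:R) ler_nat //.
have ct e : e \in crossing ends lev F t -> (lo e < t < hi e)%N.
  rewrite inE => /and3P[eF /andP[lot ->] /existsP[v /andP[ev /eqP vt]]].
  rewrite andbT ltn_neqAle lot andbT; apply: contra ht => /eqP lotE.
  have [u eu ulo] := lo_end ends lev eF.
  have uv : conn A u v by apply: conn_trans ev; rewrite conn_sym.
  have ut : lev u = t by rewrite ulo.
  by have := next_level_hit _ uv; rewrite ut vt; apply.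
apply: (@le_trans _ _ (weight x [set e | (lo e < t < hi e)%N])).
  by apply: le_weight => //; apply/subsetP => e /ct; rewrite inE.
apply: xskip; have /andP[lot _] := ct _ e0t.
by rewrite ltn_ord andbT (leq_ltn_trans _ lot).
Qed.

(** The good edges have rank at most that of the inner edges plus the number of good levels, each of
    which pays [mu]. The other edges are charged to bad levels, and [sum_rho] bounds the total. *)
Lemma closed_not_violates : ~~ violates F.
Proof.
rewrite /violates -leNgt.
have lm : 0 <= mu - lam by rewrite subr_ge0.
have mu0 : 0 <= mu by apply: le_trans lam_le; exact: ltW.
have split_weight : weight x F <= weight x (good_edges ends lev K F) +
    \sum_(t < K | ~~ good t) weight x (crossing ends lev F t).
  rewrite !weightE.
  under [X in _ <= _ + X]eq_bigr => t _ do rewrite weightE.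
  rewrite exchange_big /= -big_split /=; apply: ler_sum => e _.
  have sum0 (P : pred 'I_K) :
      0 <= \sum_(t < K | P t) x e * (e \in crossing ends lev F t)%:R.
    by apply: sumr_ge0 => t _; rewrite mulr_ge0.
  case: (boolP (e \in F)) => eF; last by rewrite mulr0 addr_ge0 // mulr_ge0.
  case: (boolP (e \in good_edges ends lev K F)) => eg; first by rewrite lerDl.
  have [t gt et] := bad_edge levK eF eg.
  by rewrite mulr0 add0r (bigD1 t) //= et lerDl sum0.
apply: le_trans split_weight _.
have gw : weight x (good_edges ends lev K F) <=
    mu * (r (F :&: Iset))%:R + \sum_(t < K | good t) mu.
  apply: le_trans (weight_le_erk _ x_ge0 xU) _.
  have := erk_good_edges levK same_level_conn.
  rewrite -(ler_nat R) natrD natr_sum => /(ler_wpM2l mu0)/le_trans; apply.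
  rewrite mulrDr lerD2l mulr_sumr [leRHS]big_mkcond ler_sum // => t _.
  by case: good; rewrite ?mulr1 ?mulr0.
have gsum : \sum_(t < K | good t) mu + \sum_(t < K | ~~ good t)
    weight x (crossing ends lev F t) <=
    lam * (nhit ends lev K F)%:R + (mu - lam) * (\sum_(t < K) rho t)%:R.
  rewrite !natr_sum !mulr_sumr -big_split /= [leRHS](bigID (fun t : 'I_K => good t)) /=.
  apply: lerD; apply: ler_sum => t gt; last exact: crossing_weight.
  by move: gt => /andP[-> /eqP ->]; rewrite !mulr1 addrC subrK.
have := sum_rho ends levK F; rewrite -(ler_nat R) natrD -subr_ge0.
move=> /(mulr_ge0 lm); rewrite /lrk natrD; move: gw gsum.
move: (\sum_(t < K | good t) _) (\sum_(t < K | ~~ good t) _) => ? ?; lra.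
Qed.

End MaximalViolator.

Lemma rank_inequality F :
  weight x F <= lam * (r1 F)%:R + (mu - lam) * (r F)%:R.
Proof.
rewrite leNgt; apply/negP => F0viol.
case: (@arg_maxnP _ F violates (fun G : {set E} => #|G|) F0viol) => {F F0viol}.
move=> F Fviol Fmax.
have noaug a b u v (M := lev_in a b) (D := F :&: induced_edges ends M) :
    (a < b <= K.+1)%N -> D \subset inner ends lev -> u \in M -> v \in M ->
    conn (ends @: F) u v -> conn (ends @: D) u v.
  move=> ab DI uM vM uvF; apply/negPn/negP => uvD.
  have [/Fmax + /proper_card] := augment ab DI uM vM uvF uvD Fviol.
  by move=> /leq_ltn_trans /[apply]; rewrite ltnn.
suff : ~~ violates F by rewrite Fviol.
apply: closed_not_violates => [u v uv uvF|u v uv uvF].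
  have DI : F :&: induced_edges ends (lev_in (lev u) (lev u).+1)
      \subset F :&: inner ends lev.
    apply: setIS; apply/subsetP => e; rewrite mem_induced innerP !inE.
    by clear; lia.
  apply: conn_subset (imsetS ends DI) _.
  apply: noaug => //; rewrite ?inE -?uv ?leqnn ?ltnSn ?ltnS ?levK //.
  exact: subset_trans DI (subsetIr _ _).
case: (boolP (hit_level ends lev F (lev u))) => // nohit.
(* With no hit between the two levels, all edges of [F] inside them are inner and cannot connect [u]
   to [v]. *)
have DI : F :&: induced_edges ends (lev_in (lev u) (lev u).+2)
    \subset inner ends lev.
  apply/subsetP => e; rewrite inE mem_induced innerP => /andP[eF ee].
  apply: contraNT nohit => e12; apply/existsP; exists e; rewrite eF /=.
  move: ee e12; rewrite /hits_level /low_level /high_level !inE.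
  by clear; lia.
have : conn (ends @: (F :&: induced_edges ends (lev_in (lev u) (lev u).+2))) u v.
  apply: noaug => //; rewrite ?inE ?uv ?leqnn ?leqnSn ?ltnS //.
  by rewrite -uv levK.
move/(conn_const (g := lev)) => uvE.
suff : lev u = lev v by move: uv; clear; lia.
by apply: uvE => p /imsetP[e /(subsetP DI)]; rewrite innerP => /eqP e12 ->.
Qed.

End RankInequality.

(** * Chains and the spanning tree polytope *)

Section Polytope.
Variables (R : realType) (V E : finType) (ends : E -> V * V).
Implicit Types (x y : E -> R) (A B S U : {set V}) (mu : R).

Local Notation ind := (induced_edges ends).
Local Notation cut := (cut ends).

(** With the factor on the right-hand sides, [mu = 0] makes sense and leaves only the zero
    vector. *)
Definition in_scaled_polytope mu x : Prop :=
  [/\ forall e, 0 <= x e,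
      forall U, U != set0 -> weight x (ind U) <= mu * (#|U|%:R - 1)
    & weight x setT = mu * (#|V|%:R - 1)].

Lemma weight_split x U :
  weight x setT = weight x (ind U) + weight x (ind (~: U)) + weight x (cut U).
Proof.
rewrite !weightE -!big_split; apply: eq_bigr => e _ /=; rewrite !inE.
by case: (_ \in U); case: (_ \in U); rewrite /=; lra.
Qed.

Lemma weight_cut_setD x A B : A \subset B ->
  weight x (cut A) + weight x (cut B) =
  weight x (cut (B :\: A)) + 2 * weight x (edges_between ends A (~: B)).
Proof.
move=> /subsetP AB; rewrite !weightE mulr_sumr -!big_split; apply: eq_bigr => e _.
rewrite /= !inE.
case: ((ends e).1 \in A) (AB (ends e).1) => [/(_ isT) ->|_];
case: ((ends e).2 \in A) (AB (ends e).2) => [/(_ isT) ->|_];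
case: ((ends e).1 \in B); case: ((ends e).2 \in B) => /=; lra.
Qed.

Lemma weight_induced_setD x A B : A \subset B ->
  weight x (ind B) + weight x (edges_between ends A (~: B)) =
  weight x (ind A) + weight x (ind (B :\: A)) + weight x (cut A).
Proof.
move=> /subsetP AB; rewrite !weightE -!big_split; apply: eq_bigr => e _.
rewrite /= !inE.
case: ((ends e).1 \in A) (AB (ends e).1) => [/(_ isT) ->|_];
case: ((ends e).2 \in A) (AB (ends e).2) => [/(_ isT) ->|_];
case: ((ends e).1 \in B); case: ((ends e).2 \in B) => /=; lra.
Qed.

Lemma polytope_loop mu x e : in_scaled_polytope mu x ->
  (ends e).1 = (ends e).2 -> x e = 0.
Proof.
case=> x0 xU _ ee; apply/eqP; rewrite eq_le x0 andbT.
have := xU [set (ends e).1]; rewrite cards1 subrr mulr0 => /(_ _).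
have -> : [set (ends e).1] != set0 by apply/set0Pn; exists (ends e).1; rewrite inE.
move=> /(_ isT); apply: le_trans; rewrite /weight (bigD1 e) /=.
  by rewrite lerDl sumr_ge0.
by rewrite mem_induced -ee !inE eqxx.
Qed.

(** A non-loop is counted once for each end in [S]; loops lie in no cut and have weight zero. *)
Lemma weight_degree mu x S : in_scaled_polytope mu x ->
  \sum_(v in S) weight x (cut [set v]) = 2 * weight x (ind S) + weight x (cut S).
Proof.
move=> xP; under eq_bigr => v _ do rewrite weightE.
rewrite exchange_big !weightE mulr_sumr -big_split; apply: eq_bigr => e _ /=.
case: (eqVneq (ends e).1 (ends e).2) => [ee|ee].
  rewrite (polytope_loop xP ee) big1 ?mul0r ?mulr0 ?addr0 // => v _.
  by rewrite mul0r.
have count (w : V) : \sum_(v in S) (w == v)%:R = (w \in S)%:R :> R.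
  case: (boolP (w \in S)) => wS; last first.
    by rewrite big1 // => v vS; case: eqP => // wv; rewrite wv vS in wS.
  rewrite (bigD1 w) //= eqxx big1 ?addr0 // => v /andP[_ vw].
  by rewrite eq_sym (negPf vw).
rewrite (eq_bigr (fun v => x e * ((ends e).1 == v)%:R + x e * ((ends e).2 == v)%:R)).
  rewrite big_split -!mulr_sumr !count !inE.
  by case: (_ \in S); case: (_ \in S); rewrite /=; lra.
move=> v _; rewrite !inE.
case: (eqVneq (ends e).1 v) => [e1|_]; case: (eqVneq (ends e).2 v) => [e2|_] /=;
  try lra.
by rewrite e1 e2 eqxx in ee.
Qed.

(** The constraints for [S] and its complement add up to the total mass minus [mu], so both are
    tight. *)
Lemma polytope_tight mu x S : in_scaled_polytope mu x ->
  S != set0 -> S != setT -> weight x (cut S) = mu ->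
  weight x (ind S) = mu * (#|S|%:R - 1).
Proof.
move=> [x0 xU xT] S0 ST Scut.
have ST' : ~: S != set0 by apply: contra ST => /eqP; rewrite -setCT => /setC_inj ->.
have := xU _ S0; have := xU _ ST'; have := weight_split x S.
rewrite xT Scut -(cardsC S) natrD; lra.
Qed.

(** Both [A] and [B] are tight and no weight skips [B :\: A], which determines the weight inside it
    and on its cut. This yields the degree sums of Gao-trees. *)
Lemma polytope_tight_degree mu x A B : in_scaled_polytope mu x ->
  A != set0 -> B != setT -> A \proper B ->
  weight x (cut A) = mu -> weight x (cut B) = mu ->
  weight x (edges_between ends A (~: B)) = 0 ->
  \sum_(v in B :\: A) weight x (cut [set v]) = 2 * mu * #|B :\: A|%:R.
Proof.
move=> xP A0 BT AB cutA cutB AB0; rewrite (weight_degree _ xP).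
have AsB := proper_sub AB.
have AT : A != setT.
  by apply: contraTneq AB => ->; rewrite properE subsetT andbF.
have B0 : B != set0 by apply: contraTneq AB => ->; rewrite properE sub0set andbF.
have := polytope_tight xP A0 AT cutA; have := polytope_tight xP B0 BT cutB.
have := weight_cut_setD x AsB; have := weight_induced_setD x AsB.
have -> : #|B|%:R = #|A|%:R + #|B :\: A|%:R :> R.
  by rewrite -natrD -(cardsID A B) (setIidPr AsB).
rewrite cutA cutB AB0; lra.
Qed.

(** A component with empty cut would leave too few edges; a cycle would have as many edges as
    vertices, against the constraint for its vertex set. *)
Lemma polytope_spanning_tree (T : {set E}) :
  in_scaled_polytope 1 (fun e => (e \in T)%:R) -> spanning_tree ends T.
Proof.
move=> [_ TU TT].
have {}TU U : U != set0 -> (#|T :&: ind U| < #|U|)%N.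
  move=> U0; have := TU _ U0; rewrite weight_indicator mul1r lerBrDr natr1.
  by rewrite ler_nat.
split.
  pose e_rel a b := [exists e in T, joins ends e a b].
  move=> u v; rewrite -/(connect e_rel u v); apply/negPn/negP => uv.
  have esym : symmetric e_rel.
    by move=> a b; apply/existsP/existsP => -[e]; exists e; rewrite /joins orbC.
  pose U := [set w | connect e_rel u w].
  have U0 : U != set0 by apply/set0Pn; exists u; rewrite inE connect0.
  have UC0 : ~: U != set0 by apply/set0Pn; exists v; rewrite !inE.
  have := weight_split (fun e => (e \in T)%:R : R) U.
  rewrite TT !weight_indicator (_ : T :&: cut U = set0).
    rewrite mul1r cards0 addr0 => /eqP; rewrite subr_eq -natrD natr1 eqr_nat.
    move=> /eqP; have := TU _ U0; have := TU _ UC0; have := cardsC U; lia.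
  have step a b e : e \in T -> joins ends e a b -> connect e_rel u a ->
      connect e_rel u b.
    move=> eT eab ua; apply: connect_trans ua (connect1 _).
    by apply/existsP; exists e; rewrite eT.
  apply/setP => e; rewrite !inE; apply/negP => /andP[eT].
  have j1 : joins ends e (ends e).1 (ends e).2.
    by rewrite /joins -surjective_pairing eqxx.
  have j2 : joins ends e (ends e).2 (ends e).1.
    by rewrite /joins -surjective_pairing eqxx orbT.
  case/orP => /andP[].
    by move=> /(step _ _ _ eT j1) ->.
  by move=> + /(step _ _ _ eT j2) => /negP.
case=> n [v [e [v_inj e_inj eT ev]]].
have U0 : v @: setT != set0.
  by apply/set0Pn; exists (v ord0); rewrite imset_f.
have := TU _ U0; rewrite (card_imset _ v_inj) ltnNge => /negP[].
rewrite -(card_imset _ e_inj); apply: subset_leq_card; apply/subsetP => f.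
move=> /imsetP[i _ ->]; rewrite inE eT mem_induced.
by case/orP: (ev i) => /eqP -> /=; rewrite !imset_f.
Qed.

End Polytope.

(** * The levels of a chain *)

Section ChainLevels.
Variables (V E : finType) (ends : E -> V * V) (s : seq {set V}).
Hypothesis s_sorted : sorted (fun A B : {set V} => A \proper B) s.

(** A vertex in no member of the chain gets level [size s], the value of [find] on failure. *)
Definition chain_level v := find (fun S : {set V} => v \in S) s.
Local Notation lev := chain_level.
Local Notation K := (size s).
Local Notation B t := (nth set0 s t).

Lemma chain_level_le v : (lev v <= K)%N.
Proof. exact: find_size. Qed.

Lemma chain_nth_proper i j : (i < j < K)%N -> B i \proper B j.
Proof.
move=> /andP[ij jK]; apply: (sorted_ltn_nth _ _ s_sorted) => //.
  by move=> X Y Z; apply: proper_trans.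
by rewrite inE (ltn_trans ij).
Qed.

Lemma mem_chain_nth t v : (t < K)%N -> (v \in B t) = (lev v <= t)%N.
Proof.
move=> tK; apply/idP/idP => [vt|vt].
  rewrite leqNgt; apply/negP => /(before_find set0).
  by rewrite vt.
have vs : has (fun S : {set V} => v \in S) s by rewrite has_find (leq_ltn_trans vt).
have := nth_find set0 vs; rewrite -/(lev v).
move: vt; rewrite leq_eqVlt => /predU1P[->//|vt].
have lt : (lev v < t < K)%N by rewrite vt tK.
by have /proper_sub/subsetP := chain_nth_proper lt; apply.
Qed.

Local Notation lo := (low_level ends lev).
Local Notation hi := (high_level ends lev).

Lemma cut_chain t : (t < K)%N ->
  cut ends (B t) = [set e | (lo e <= t < hi e)%N].
Proof.
move=> tK; apply/setP => e; rewrite !inE !mem_chain_nth // /low_level /high_level.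
by clear; lia.
Qed.

Lemma skip_chain i j : (i < j < K)%N ->
  edges_between ends (B i) (~: B j) = [set e | (lo e <= i)%N && (j < hi e)%N].
Proof.
move=> /andP[ij jK]; have iK := ltn_trans ij jK.
apply/setP => e; rewrite !inE !mem_chain_nth // /low_level /high_level.
by move: ij; clear; lia.
Qed.

Lemma lrk_cut_chain t : (t < K)%N -> (lrk ends lev K (cut ends (B t)) <= 1)%N.
Proof.
move=> tK; rewrite cut_chain // /lrk (_ : _ :&: _ = set0).
  have [-> _ _] := erk_rank_function ends.
  apply: (@nhit_le1 _ _ _ _ _ _ t) => e m.
  by rewrite inE /hits_level; clear; lia.
by apply/setP => e; rewrite !inE; clear; lia.
Qed.

(** These edges skip level [j], so they are loops of the layered matroid. *)
Lemma lrk_skip_chain i j : (i < j < K)%N ->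
  lrk ends lev K (edges_between ends (B i) (~: B j)) = 0%N.
Proof.
move=> ijK; rewrite skip_chain // /lrk (_ : _ :&: _ = set0).
  have [-> _ _] := erk_rank_function ends; rewrite /nhit big1 // => t _.
  apply/eqP; rewrite eqb0; apply/existsP => -[e].
  by rewrite inE /hits_level; move: ijK; clear; lia.
by apply/setP => e; rewrite !inE; move: ijK; clear; lia.
Qed.

End ChainLevels.

(** * Peeling off one layer *)

Section OneLayer.
Variables (R : realType) (V E : finType) (ends : E -> V * V).
Variables (s : seq {set V}) (x : E -> R) (mu lam : R).
Hypothesis s_sorted : sorted (fun A B : {set V} => A \proper B) s.
Hypothesis s0 : forall S, S \in s -> S != set0.
Hypothesis sT : forall S, S \in s -> S != setT.
Hypothesis xP : in_scaled_polytope ends mu x.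
Hypotheses (lam_gt0 : 0 < lam) (lam_le : lam <= mu).
Hypothesis xcut : forall S, S \in s -> weight x (cut ends S) <= 2 * mu - lam.
Hypothesis xdeg : forall A B, A \in s -> B \in s -> A \proper B ->
  \sum_(v in B :\: A) weight x (cut ends [set v]) = 2 * mu * #|B :\: A|%:R.

Local Notation lev := (chain_level s).
Local Notation K := (size s).
Local Notation r1 := (lrk ends lev K).
Local Notation r := (erk ends).

Let x_ge0 e : 0 <= x e. Proof. by case: xP. Qed.
Let weight_ge0 F : 0 <= weight x F. Proof. exact: sumr_ge0. Qed.
Let mu_gt0 : 0 < mu. Proof. exact: lt_le_trans lam_le. Qed.

Let V_gt0 : (0 < #|V|)%N.
Proof.
rewrite lt0n; apply/eqP => V0; have [_ _] := xP.
by have := weight_ge0 setT; rewrite V0; move: mu_gt0; lra.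
Qed.

Let V0 : [set: V] != set0.
Proof. by rewrite -card_gt0 cardsT. Qed.

(** The degree sum is twice the weight inside [B :\: A] plus its cut, and this cut is the sum of the
    two chain cuts minus twice the skipping edges. The bounds on the chain cuts bound the inside
    weight from below; the polytope bounds it from above, leaving at most [mu - lam] for the
    skipping edges. *)
Lemma chain_interval A B : A \in s -> B \in s -> A \proper B ->
  weight x (edges_between ends A (~: B)) <= mu - lam /\
  mu * #|B :\: A|%:R - 2 * mu + lam <= weight x (induced_edges ends (B :\: A)).
Proof.
move=> As Bs AB; have AsB := proper_sub AB; have [_ xU _] := xP.
have M0 : B :\: A != set0 by rewrite setD_eq0; case/properP: AB => _ [v vB vA];
  apply/subsetPn; exists v.
have := xdeg As Bs AB; rewrite (weight_degree _ xP).
have := weight_cut_setD ends x AsB; have := xU _ M0.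
have := xcut As; have := xcut Bs.
have := weight_ge0 (edges_between ends A (~: B)).
by move=> *; split; lra.
Qed.

(** The polytope bounds the other side of the cut and the chain bounds the cut; the rest of the mass
    lies inside. *)
Lemma chain_prefix S : S \in s ->
  mu * #|S|%:R - 2 * mu + lam <= weight x (induced_edges ends S) /\
  mu * #|~: S|%:R - 2 * mu + lam <= weight x (induced_edges ends (~: S)).
Proof.
move=> Ss; have [_ xU xT] := xP; have := xcut Ss; have := weight_split ends x S.
have := xU _ (s0 Ss).
have : ~: S != set0 by apply: contra (sT Ss) => /eqP; rewrite -setCT => /setC_inj ->.
move=> /xU; rewrite xT -(cardsC S) natrD => *; split; lra.
Qed.

Lemma chain_rank_inequality F :
  weight x F <= lam * (r1 F)%:R + (mu - lam) * (r F)%:R.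
Proof.
have [_ xU xT] := xP.
apply: rank_inequality => // [v|t tK|t /andP[t0 tK]|a b /andP[ab bK]].
- exact: chain_level_le.
- by rewrite -(cut_chain ends s_sorted tK) xcut // mem_nth.
- have tt : (t.-1 < t < K)%N by rewrite tK andbT prednK.
  have -> : [set e | (low_level ends lev e < t < high_level ends lev e)%N] =
      edges_between ends (nth set0 s t.-1) (~: nth set0 s t).
    rewrite (skip_chain ends s_sorted tt); apply/setP => e; rewrite !inE.
    by move: t0; clear; lia.
  have tK' : (t.-1 < K)%N by case/andP: tt => /ltn_trans; apply.
  have := chain_nth_proper s_sorted tt.
  by move=> /(chain_interval (mem_nth set0 tK') (mem_nth set0 tK))[].
(* Levels [a] to [b - 1] form the difference of the members [b - 1] and [a - 1]; the extremes
   [a = 0] and [b = K + 1] give a member, a complement or all of [V]. *)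
- move: bK; rewrite leq_eqVlt => /predU1P[bK|bK].
    case: a ab => [|a] ab.
      rewrite (_ : [set v | _] = setT); last first.
        by apply/setP => v; rewrite !inE bK ltnS chain_level_le.
      rewrite (_ : induced_edges ends setT = setT); last first.
        by apply/setP => e; rewrite mem_induced !inE.
      by rewrite xT cardsT; move: lam_le; lra.
    have aK : (a < K)%N by move: ab; rewrite bK.
    rewrite (_ : [set v | _] = ~: nth set0 s a).
      by have [] := chain_prefix (mem_nth set0 aK).
    apply/setP => v; rewrite !inE mem_chain_nth // -ltnNge bK.
    by rewrite [(lev v < K.+1)%N]ltnS chain_level_le andbT.
  case: b ab bK => // b ab bK; rewrite ltnS in bK.
  case: a ab => [|a] ab.
    rewrite (_ : [set v | _] = nth set0 s b).
      by have [] := chain_prefix (mem_nth set0 bK).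
    by apply/setP => v; rewrite !inE mem_chain_nth.
  have abK : (a < b < K)%N by rewrite bK andbT.
  have aK : (a < K)%N by apply: ltn_trans bK.
  rewrite (_ : [set v | _] = nth set0 s b :\: nth set0 s a).
    have := chain_nth_proper s_sorted abK.
    by move=> /(chain_interval (mem_nth set0 aK) (mem_nth set0 bK))[].
  by apply/setP => v; rewrite !inE !mem_chain_nth // -ltnNge ltnS.
Qed.

(** Both ranks are below [#|V|]. The mass of [x] forces the graphic rank up to [#|V|.-1], and then
    the rank inequality for all edges forces the layered rank up too. *)
Lemma ranks_setT : r1 setT = #|V|.-1 /\ r setT = #|V|.-1.
Proof.
have indT : induced_edges ends setT = setT.
  by apply/setP => e; rewrite mem_induced !inE.
have h1 := lrk_induced_le ends (@chain_level_le _ s) V0.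
have h2 := erk_induced_le V0 (subxx (induced_edges ends setT)).
rewrite indT cardsT in h1 h2.
have [_ xU xT] := xP.
have rT : r setT = #|V|.-1.
  apply/eqP; rewrite eqn_leq; apply/andP; split; first by lia.
  have := weight_le_erk setT x_ge0 xU; rewrite xT ler_pM2l //.
  by rewrite lerBlDr natr1 ler_nat; lia.
split=> //; apply/eqP; rewrite eqn_leq; apply/andP; split; first by lia.
rewrite -(ler_nat R) -(ler_pM2l lam_gt0).
have := chain_rank_inequality setT; rewrite rT xT.
have -> : #|V|%:R = #|V|.-1%:R + 1 :> R by rewrite natr1 prednK.
by rewrite addrK; lra.
Qed.

Lemma lrk_base_polytope T : base r1 T ->
  in_scaled_polytope ends 1 (fun e => (e \in T)%:R : R).
Proof.
move=> /andP[/forallP TS /eqP TT]; have [r1T _] := ranks_setT; split=> // [U U0|].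
  rewrite weight_indicator mul1r lerBrDr natr1 ler_nat.
  exact: leq_ltn_trans (TS _) (lrk_induced_le _ (@chain_level_le _ s) U0).
by rewrite weight_indicator setIT TT r1T mul1r -(prednK V_gt0) /= -natr1 addrK.
Qed.

Lemma erk_base_polytope T : base r T ->
  in_scaled_polytope ends 1 (fun e => (e \in T)%:R : R).
Proof.
move=> /andP[/forallP TS /eqP TT]; have [_ rT] := ranks_setT; split=> // [U U0|].
  rewrite weight_indicator mul1r lerBrDr natr1 ler_nat.
  exact: leq_ltn_trans (TS _) (erk_induced_le U0 (subxx _)).
by rewrite weight_indicator setIT TT rT mul1r -(prednK V_gt0) /= -natr1 addrK.
Qed.

(** The cut has layered rank at most one, and the constraints for its two sides leave at least one
    edge for it. *)
Lemma lrk_base_cut T S : base r1 T -> S \in s -> #|T :&: cut ends S| = 1%N.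
Proof.
move=> bT Ss; have [_ TU TT] := lrk_base_polytope bT.
case/andP: bT => /forallP TS _.
apply/eqP; rewrite eqn_leq; apply/andP; split.
  apply: leq_trans (TS _) _; rewrite -(nth_index set0 Ss).
  by apply: lrk_cut_chain; rewrite ?index_mem.
rewrite -(ler_nat R) -weight_indicator.
have := weight_split ends (fun e => (e \in T)%:R : R) S.
have := TU _ (s0 Ss).
have : ~: S != set0 by apply: contra (sT Ss) => /eqP; rewrite -setCT => /setC_inj ->.
move=> /TU; rewrite TT -(cardsC S) natrD; lra.
Qed.

Lemma lrk_base_skip T A B : base r1 T -> A \in s -> B \in s -> A \proper B ->
  #|T :&: edges_between ends A (~: B)| = 0%N.
Proof.
move=> /andP[/forallP TS _] As Bs AB; apply/eqP; rewrite -leqn0.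
apply: leq_trans (TS _) _; rewrite -(nth_index set0 As) -(nth_index set0 Bs).
rewrite lrk_skip_chain // index_mem Bs andbT.
rewrite ltnNge leq_eqVlt; apply/negP => /predU1P[BA|BA].
  by move: AB; rewrite -(nth_index set0 As) -(nth_index set0 Bs) BA properE andbN.
have BAs : (index B s < index A s < size s)%N by rewrite BA index_mem.
have := chain_nth_proper s_sorted BAs; rewrite !nth_index // => /(proper_trans AB).
by rewrite properE andbN.
Qed.

Lemma lrk_base_Gao T : base r1 T -> Gao_tree ends [set S in s] T.
Proof.
move=> bT; split; first exact: polytope_spanning_tree (lrk_base_polytope bT).
by move=> S; rewrite inE; exact: lrk_base_cut.
Qed.

Lemma weight_convex (J : finType) (P : pred J) (c : J -> R) (p : J -> E -> R) F :
  weight (fun e => \sum_(j | P j) c j * p j e) F =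
  \sum_(j | P j) c j * weight (p j) F.
Proof.
by rewrite /weight exchange_big; apply: eq_bigr => j _; rewrite mulr_sumr.
Qed.

Lemma polytope_convex (J : finType) (P : pred J) (c : J -> R)
    (p : J -> E -> R) (nu : R) :
  (forall j, 0 <= c j) -> \sum_(j | P j) c j = 1 ->
  (forall j, P j -> in_scaled_polytope ends nu (p j)) ->
  in_scaled_polytope ends nu (fun e => \sum_(j | P j) c j * p j e).
Proof.
move=> c0 c1 pP.
have sumc m : \sum_(j | P j) c j * m = m by rewrite -mulr_suml c1 mul1r.
split=> [e|U U0|].
- by apply: sumr_ge0 => j /pP[p0 _ _]; rewrite mulr_ge0.
- rewrite weight_convex -[leRHS]sumc; apply: ler_sum => j /pP[_ pU _].
  by rewrite ler_wpM2l // pU.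
- by rewrite weight_convex -[RHS]sumc; apply: eq_bigr => j /pP[_ _ ->].
Qed.

(** In a decomposition into pairs of bases, the first components average to [y] and the scaled
    second ones to [z]. The cuts and degree sums of [y] are fixed, so those of [z] follow by
    linearity. *)
Lemma one_layer : exists y z : E -> R,
  [/\ in_convex_hull (Gao_tree ends [set S in s]) y,
      in_scaled_polytope ends (mu - lam) z,
      forall e, x e = lam * y e + z e,
      forall S, S \in s -> weight z (cut ends S) = weight x (cut ends S) - lam
    & forall A B, A \in s -> B \in s -> A \proper B ->
        \sum_(v in B :\: A) weight z (cut ends [set v]) =
        2 * (mu - lam) * #|B :\: A|%:R].
Proof.
have [_ _ xT] := xP; have [r1T rT] := ranks_setT.
have lm : 0 <= mu - lam by rewrite subr_ge0.
have VE : #|V|%:R = #|V|.-1%:R + 1 :> R by rewrite natr1 prednK.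
have [|c] := rank_sum_decomposition (lrk_rank_function ends lev K)
  (erk_rank_function ends) (ltW lam_gt0) lm chain_rank_inequality.
  by rewrite r1T rT xT VE; lra.
set P := fun p : {set E} * {set E} => _.
case=> c0 c1 xE.
pose y e := \sum_(p | P p) c p * (e \in p.1)%:R.
pose z e := \sum_(p | P p) c p * ((mu - lam) * (e \in p.2)%:R).
have xyz e : x e = lam * y e + z e.
  rewrite xE /y /z mulr_sumr -big_split; apply: eq_bigr => p _ /=; ring.
have yP : in_scaled_polytope ends 1 y.
  apply: polytope_convex => // p /andP[bp _]; exact: lrk_base_polytope.
have zP : in_scaled_polytope ends (mu - lam) z.
  apply: polytope_convex => // p /andP[_ /erk_base_polytope[q0 qU qT]].
  have qE F : weight (fun e => (mu - lam) * (e \in p.2)%:R) F =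
      (mu - lam) * weight (fun e => (e \in p.2)%:R) F.
    by rewrite /weight mulr_sumr.
  split=> [e|U U0|]; first by rewrite mulr_ge0.
    by rewrite qE ler_wpM2l // -[leRHS]mul1r qU.
  by rewrite qE qT mul1r.
have ycard F n : (forall T, base r1 T -> #|T :&: F| = n) -> weight y F = n%:R.
  move=> Fn; have <- : \sum_(p | P p) c p * n%:R = n%:R :> R.
    by rewrite -mulr_suml c1 mul1r.
  rewrite weight_convex.
  by apply: eq_bigr => p /andP[bp _]; rewrite weight_indicator Fn.
have zE F : weight z F = weight x F - lam * weight y F.
  rewrite /weight mulr_sumr -sumrB; apply: eq_bigr => e _.
  by rewrite xyz addrC addKr.
have ycut S : S \in s -> weight y (cut ends S) = 1.
  by move=> Ss; rewrite (ycard _ 1%N) // => T bT; exact: lrk_base_cut.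
exists y, z; split=> //.
- exists #|P|, (fun i => c (enum_val i)), (fun i => (enum_val i).1).
  split=> // [||e].
  + by rewrite -(big_enum_val c); exact: c1.
  + by move=> i; have /andP[/lrk_base_Gao] := enum_valP i.
  + exact: (big_enum_val (fun p => c p * (e \in p.1)%:R)).
- by move=> S Ss; rewrite zE ycut // mulr1.
- move=> A B As Bs AB.
  under eq_bigr => v _ do rewrite zE.
  rewrite sumrB -mulr_sumr xdeg // (polytope_tight_degree yP) ?s0 ?sT ?ycut //.
    ring.
  by rewrite (ycard _ 0%N) // => T bT; exact: lrk_base_skip.
Qed.

End OneLayer.

(** * Induction over the layers *)

Lemma in_convex_hull_sub (R : realType) (E : finType) (B B' : {set E} -> Prop)
    (y : E -> R) :
  (forall T, B T -> B' T) -> in_convex_hull B y -> in_convex_hull B' y.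
Proof.
move=> BB [n [c [T [c0 c1 BT yE]]]]; exists n, c, T; split=> // i.
exact: BB.
Qed.

(** After the first layer, the cuts of weight exactly [2 * mu - lam 0] leave the chain; the others
    fit the smaller mass with [lam] shifted by one. *)
Lemma layered_decomposition (R : realType) (V E : finType) (ends : E -> V * V)
    (l : nat) (lam : nat -> R) (mu : R) (x : E -> R) (s : seq {set V}) :
  (forall j, (j < l)%N -> 0 < lam j) -> mu = \sum_(j < l) lam j ->
  sorted (fun A B : {set V} => A \proper B) s ->
  (forall S, S \in s -> S != set0) -> (forall S, S \in s -> S != setT) ->
  in_scaled_polytope ends mu x ->
  (forall A B, A \in s -> B \in s -> A \proper B ->
     \sum_(v in B :\: A) weight x (cut ends [set v]) = 2 * mu * #|B :\: A|%:R) ->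
  (forall S, S \in s -> exists2 j, (j < l)%N &
     weight x (cut ends S) = 2 * mu - \sum_(i < j.+1) lam i) ->
  exists y : nat -> E -> R,
    (forall j, (j < l)%N -> in_convex_hull (Gao_tree ends
       [set S in s | weight x (cut ends S) <= 2 * mu - \sum_(i < j.+1) lam i])
       (y j)) /\
    forall e, x e = \sum_(j < l) lam j * y j e.
Proof.
elim: l lam mu x s => [|l IHl] lam mu x s lam0 muE ss s0 sT xP xdeg xcut.
  (* Without layers the mass is zero, so [x] vanishes. *)
  exists (fun=> x); split=> // e; rewrite big_ord0.
  have [x0 _] := xP; rewrite muE big_ord0 mul0r => /eqP.
  rewrite psumr_eq0 // => /allP/(_ e); rewrite mem_index_enum inE.
  by move=> /(_ isT)/eqP.
have lam_sum n : (n <= l)%N -> 0 <= \sum_(i < n) lam i.+1.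
  by move=> nl; apply: sumr_ge0 => i _; apply/ltW/lam0; rewrite ltnS (leq_trans _ nl).
have muE' : mu - lam 0%N = \sum_(j < l) lam j.+1.
  by rewrite muE big_ord_recl addrC addKr.
have lam_le : lam 0%N <= mu by rewrite -subr_ge0 muE' lam_sum.
have xcut0 S : S \in s -> weight x (cut ends S) <= 2 * mu - lam 0%N.
  move=> /xcut[j jl ->]; rewrite big_ord_recl; have := lam_sum j jl; lra.
have [y0 [z [y0P zP xE zcut zdeg]]] :=
  one_layer ss s0 sT xP (lam0 0%N isT) lam_le xcut0 xdeg.
pose s' := [seq S <- s | weight x (cut ends S) < 2 * mu - lam 0%N].
have s's S : S \in s' -> S \in s by rewrite mem_filter => /andP[].
have [||||A B /s's As /s's Bs||y [yP zE]] :=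
    IHl (fun j => lam j.+1) (mu - lam 0%N) z s' _ muE' _ _ _ zP.
- by move=> j jl; apply: lam0.
- by apply: sorted_filter ss => A B C; exact: proper_trans.
- by move=> S /s's/s0.
- by move=> S /s's/sT.
- exact: zdeg.
- move=> S Ss'; have Ss := s's _ Ss'.
  move: Ss'; rewrite mem_filter => /andP[+ _].
  have [[|j] jl Sj] := xcut _ Ss; rewrite Sj.
    by rewrite big_ord1 ltxx.
  by move=> _; exists j => //; rewrite zcut // Sj big_ord_recl; lra.
exists (fun j => if j is j'.+1 then y j' else y0); split=> [[_|j jl]|e].
- apply: in_convex_hull_sub y0P => T [tT Tcut]; split=> // S; rewrite inE.
  by case/andP => Ss _; apply: Tcut; rewrite inE.
- apply: in_convex_hull_sub (yP j jl) => T [tT Tcut]; split=> // S; rewrite inE.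
  rewrite big_ord_recl => /andP[Ss Sle]; apply: Tcut.
  (* Positivity of the later layers makes the bound on the cut of [S] strict, so [S] remains in
     [s']. *)
  have lamS : 0 < \sum_(i < j.+1) lam i.+1.
    rewrite big_ord_recr /= ltr_wpDl ?lam0 // lam_sum //; exact: ltnW.
  rewrite inE mem_filter Ss zcut // andbT; move: Sle lamS => /=.
  by move=> *; apply/andP; split; lra.
- by rewrite xE zE big_ord_recl.
Qed.

(** * Indexed chains as sorted sequences *)

Section ChainSequence.
Variables (V : finType) (k : nat) (C : 'I_k.+1 -> {set V}).
Hypothesis C_lt : forall i j : 'I_k.+1, (i < j)%N -> C i \proper C j.

Definition chain_seq := mkseq (fun i => C (inord i)) k.+1.

Lemma chain_seqP S : reflect (exists i, S = C i) (S \in chain_seq).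
Proof.
apply: (iffP mapP) => [[i _ ->]|[i ->]]; first by exists (inord i).
by exists (val i); rewrite ?mem_iota ?ltn_ord ?inord_val.
Qed.

Lemma chain_seq_sorted : sorted (fun A B : {set V} => A \proper B) chain_seq.
Proof.
apply/(sortedP set0) => i; rewrite size_mkseq => ik.
by rewrite !nth_mkseq ?(ltnW ik) //; apply: C_lt; rewrite !inordK ?(ltnW ik).
Qed.

Lemma chain_atE i : (i <= k)%N -> chain_at C i = C (inord i).
Proof.
move=> ik; rewrite /chain_at; case: insubP => [j _ ji|]; last by rewrite ltnS ik.
by congr C; apply: val_inj; rewrite /= ji inordK.
Qed.

(** [C j :\: C i] is the disjoint union of the levels after [i] up to [j]. Two functions are
    compared so that degrees can be measured against a constant. *)
Lemma sum_levels (M : nmodType) (f g : V -> M) (i j : 'I_k.+1) :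
  (forall t, (1 <= t <= k)%N ->
     \sum_(v in level C t) f v = \sum_(v in level C t) g v) ->
  (i <= j)%N -> \sum_(v in C j :\: C i) f v = \sum_(v in C j :\: C i) g v.
Proof.
move=> fg ij.
suff levels d : (i + d <= k)%N -> \sum_(v in C (inord (i + d)) :\: C i) f v =
    \sum_(v in C (inord (i + d)) :\: C i) g v.
  by have := levels (j - i)%N; rewrite subnKC // inord_val -ltnS ltn_ord; apply.
elim: d => [|d IHd] dk; first by rewrite addn0 inord_val setDv !big_set0.
rewrite addnS in dk *; have dk' := ltnW dk.
set A := C (inord (i + d)); set B := C (inord (i + d).+1).
have AB : A \subset B by apply/proper_sub/C_lt; rewrite !inordK.
have iA : C i \subset A.
  rewrite /A; case: d {IHd A B AB} dk dk' => [|d] dk dk'.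
    by rewrite addn0 inord_val.
  by apply/proper_sub/C_lt; rewrite inordK // addnS ltnS leq_addr.
have BD : (B :\: C i) :&: A = A :\: C i.
  by rewrite setIDAC (setIidPr AB).
have BDD : (B :\: C i) :\: A = level C (i + d).+1.
  by rewrite /level !chain_atE // setDDl (setUidPr iA).
rewrite (big_setID A) [RHS](big_setID A) /= BD BDD IHd // fg //.
Qed.

End ChainSequence.

Theorem theorem1 (R : realType) (V E : finType) (ends : E -> V * V)
    (k : nat) (C : 'I_k.+1 -> {set V}) (x : E -> R)
    (l : nat) (lam : 'I_l -> R) :
  is_chain C ->
  chain_point ends C x ->
  narrow_cut_layers ends C x lam ->
  exists y : 'I_l -> E -> R, layered_convex_combination ends C x lam y.
Proof.
move=> [C0 C_lt CT] [[x0 xU xT] _ xdeg] [lam_gt0 layers lam1].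
(* The default 0 lies outside the range of all sums, which stop below [l]. *)
pose lamN n := if insub n is Some j then lam j else 0.
have lamNE (j : 'I_l) : lamN j = lam j by rewrite /lamN valK.
have C_nonempty i : C i != set0.
  case: (posnP i) => [i0|i0]; first by rewrite (_ : i = ord0) //; exact: val_inj.
  by apply: contraTneq (C_lt ord0 i i0) => ->; rewrite properE sub0set andbF.
have C_ne_setT i : C i != setT.
  have [ik|ik] := ltnP i k.
    have /C_lt : (i < (ord_max : 'I_k.+1))%N by [].
    by apply: contraTneq => ->; rewrite properE subsetT andbF.
  have -> : i = ord_max.
    by apply: val_inj; apply/eqP; rewrite eqn_leq ik -ltnS ltn_ord.
  by apply: contraTneq CT => ->; rewrite properE subxx.
have xP : in_scaled_polytope ends 1 x.
  by split=> // [U U0|]; rewrite mul1r ?xU.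
have layerE (j : 'I_l) : 2 * 1 - \sum_(i < j.+1) lamN i = layer_value lam j.
  rewrite mulr1 /layer_value (big_ord_widen l) //; congr (_ - _).
  by apply: eq_big => // i _; rewrite lamNE.
have [|||S|S|A B|S|y [yP xE]] := @layered_decomposition R V E ends l lamN 1 x
    (chain_seq C) _ _ _ _ _ xP.
- by move=> j jl; have := lam_gt0 (Ordinal jl); rewrite -lamNE.
- by rewrite (eq_bigr lam) => [|j _]; [lra|exact: lamNE].
- exact: chain_seq_sorted.
- by move=> /chain_seqP[i ->].
- by move=> /chain_seqP[i ->].
- move=> /chain_seqP[i ->] /chain_seqP[j ->] ij.
  have ltij : (i < j)%N.
    rewrite ltnNge leq_eqVlt; apply/negP => /predU1P[/val_inj ji|/C_lt ji].
      by rewrite ji properE andbN in ij.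
    by have := proper_trans ij ji; rewrite properE andbN.
  have -> : 2 * 1 * #|C j :\: C i|%:R = \sum_(v in C j :\: C i) (2 : R).
    by rewrite sumr_const mulr1 mulr_natr.
  apply: (sum_levels C_lt _ (ltnW ltij)) => t tk.
  by rewrite (xdeg _ tk) sumr_const mulr_natr.
- move=> /chain_seqP[i ->].
  have [/(_ (ex_intro _ i erefl))[j jE] _] := layers (weight x (cut ends (C i))).
  by exists j; rewrite ?ltn_ord // layerE.
exists (fun j => y j); split=> [j|e]; last first.
  by rewrite xE; apply: eq_bigr => j _; rewrite lamNE.
apply: in_convex_hull_sub (yP j (ltn_ord j)) => T [tT Tcut]; split=> // S.
move=> /imsetP[i + ->]; rewrite inE => iw; apply: Tcut.
by rewrite inE layerE iw andbT; apply/chain_seqP; exists i.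
Qed.
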